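(* Let $\phi(R)$ be a first-order sentence that defines a union-closed property of $R$. Then $\phi$ is equivalent to some myopic sentence. Consequently, every first-order definable union-closed property of relations is definable in Inclusion Logic: there is an Inclusion Logic formula $\phi^+(\bar x)$ (with $|\bar x|=\mathrm{ar}(R)$) such that for all models $M$ and teams $X$ on $M$ (with domain containing the variables of $\bar x$), $M\models_X\phi^+(\bar x)$ iff $(M,X(\bar x))\models\phi(R)$.
   Context: $\phi(R)$ defines a union-closed property of $R$ if for every model $M$ (of the signature without $R$) and every family $(P_i)_{i\in I}$ of relations on $\mathrm{dom}(M)$ of the arity of $R$, if $(M,P_i)\models\phi(R)$ for all $i\in I$ then $(M,\bigcup_{i\in I}P_i)\models\phi(R)$. A sentence is myopic if it has the form $\forall\bar x(R\bar x\rightarrow\theta(R,\bar x))$ with $\theta$ first-order and $R$ occurring only positively in $\theta$. A team $X$ over $M$ is a set of assignments into $\mathrm{dom}(M)$; $X(\bar x)=\{\bar x\langle s\rangle:s\in X\}$. Inclusion Logic formulas are first-order formulas in negation normal form plus inclusion atoms $\bar t_1\subseteq\bar t_2$, with lax team semantics: literals hold in $X$ iff they hold under every $s\in X$; $M\models_X\bar t_1\subseteq\bar t_2$ iff $X(\bar t_1)\subseteq X(\bar t_2)$; $M\models_X\phi\vee\psi$ iff $X=Y\cup Z$ with $M\models_Y\phi$, $M\models_Z\psi$; $\wedge$ is conjunction; $M\models_X\exists v\phi$ iff $M\models_{X[H/v]}\phi$ for some $H:X\to\mathcal P(\mathrm{dom}(M))\setminus\{\emptyset\}$, where $X[H/v]=\{s[m/v]:s\in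 X,m\in H(s)\}$; $M\models_X\forall v\phi$ iff $M\models_{X[M/v]}\phi$, where $X[M/v]=\{s[m/v]:s\in X,m\in\mathrm{dom}(M)\}$. *)

(* Defs.v *)
From mathcomp Require Import all_boot.
From mathcomp Require Import boolp classical_sets.

Set Implicit Arguments.
Unset Strict Implicit.
Unset Printing Implicit Defensive.

Local Open Scope classical_set_scope.

(* Constants are the function symbols of arity 0; n-tuples over A are functions
   'I_n -> A; variables are natural numbers. *)
Record signature := Signature {
  fsym : Type;
  far : fsym -> nat;
  rsym : Type;
  rar : rsym -> nat }.
Arguments far : clear implicits.
Arguments rar : clear implicits.

Record model (L : signature) := Model {
  dom :> Type;
  dom_inhabited : inhabited dom;
  funI : forall f : fsym L, ('I_(far L f) -> dom) -> dom;
  relI : forall r : rsym L, set ('I_(rar L r) -> dom) }.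

Inductive term (L : signature) :=
| Var of nat
| App (f : fsym L) of ('I_(far L f) -> term L).
Arguments Var {L} _.

Inductive formula (L : signature) :=
| FEq of term L & term L
| FRel (r : rsym L) of ('I_(rar L r) -> term L)
| FNot of formula L
| FAnd of formula L & formula L
| FOr of formula L & formula L
| FImp of formula L & formula L
| FAll of nat & formula L
| FEx of nat & formula L.

Fixpoint term_vars L (t : term L) : set nat :=
  match t with
  | Var v => [set v]
  | App _ a => \bigcup_i term_vars (a i)
  end.

Fixpoint fv L (p : formula L) : set nat :=
  match p with
  | FEq t u => term_vars t `|` term_vars u
  | FRel _ a => \bigcup_i term_vars (a i)
  | FNot q => fv q
  | FAnd q r | FOr q r | FImp q r => fv q `|` fv r
  | FAll v q | FEx v q => fv q `\ v
  end.

Definition sentence L (p : formula L) := fv p = set0.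

Section FirstOrderSemantics.
Variables (L : signature) (M : model L).

Fixpoint eval (s : nat -> M) (t : term L) : M :=
  match t with
  | Var v => s v
  | App f a => funI (fun i => eval s (a i))
  end.

Definition upd (s : nat -> M) (v : nat) (m : M) : nat -> M :=
  fun w => if w == v then m else s w.

Fixpoint sat (s : nat -> M) (p : formula L) : Prop :=
  match p with
  | FEq t u => eval s t = eval s u
  | FRel r a => relI (fun i => eval s (a i))
  | FNot q => ~ sat s q
  | FAnd q r => sat s q /\ sat s r
  | FOr q r => sat s q \/ sat s r
  | FImp q r => sat s q -> sat s r
  | FAll v q => forall m, sat (upd s v m) q
  | FEx v q => exists m, sat (upd s v m) q
  end.

(* Truth in M of a sentence, which does not depend on the assignment. *)
Definition models (p : formula L) := forall s : nat -> M, sat s p.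

End FirstOrderSemantics.

Definition equivalent L (p q : formula L) :=
  forall M : model L, models M p <-> models M q.

(* The signature L with an additional n-ary relation symbol R, namely None. *)
Definition add_rel (L : signature) (n : nat) : signature :=
  {| fsym := fsym L;
     far := far L;
     rsym := option (rsym L);
     rar := fun r => if r is Some q then rar L q else n |}.

(* The model (M, P), in which R is interpreted by P. *)
Definition expand L n (M : model L) (P : set ('I_n -> M)) :
    model (add_rel L n) :=
  @Model (add_rel L n) M (dom_inhabited M) (@funI L M)
    (fun r => match r with Some q => @relI L M q | None => P end).

Definition union_closed L n (p : formula (add_rel L n)) :=
  forall (M : model L) (I : Type) (P : I -> set ('I_n -> M)),
    (forall i, models (expand (P i)) p) ->
    models (expand (\bigcup_i P i)) p.

(* All occurrences of R in p are positive if b, negative if ~~ b. *)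
Fixpoint polarity L n (b : bool) (p : formula (add_rel L n)) : bool :=
  match p with
  | FEq _ _ => true
  | FRel r _ => if r is Some _ then true else b
  | FNot q => polarity (~~ b) q
  | FAnd q r | FOr q r => polarity b q && polarity b r
  | FImp q r => polarity (~~ b) q && polarity b r
  | FAll _ q | FEx _ q => polarity b q
  end.

Definition forall_tuple L n (x : 'I_n -> nat) (p : formula L) : formula L :=
  foldr (@FAll L) p [seq x i | i <- enum 'I_n].

Definition myopic L n (p : formula (add_rel L n)) :=
  exists (x : 'I_n -> nat) (theta : formula (add_rel L n)),
    [/\ injective x,
        fv theta `<=` range x,
        polarity true theta &
        p = forall_tuple x
              (FImp (@FRel (add_rel L n) None (fun i => Var (x i))) theta)].

Inductive iformula (L : signature) :=
| IEq of term L & term L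
| INeq of term L & term L
| IRel (r : rsym L) of ('I_(rar L r) -> term L)
| INRel (r : rsym L) of ('I_(rar L r) -> term L)
| IInc (k : nat) of ('I_k -> term L) & ('I_k -> term L)
| IAnd of iformula L & iformula L
| IOr of iformula L & iformula L
| IAll of nat & iformula L
| IEx of nat & iformula L.

Fixpoint ifv L (p : iformula L) : set nat :=
  match p with
  | IEq t u | INeq t u => term_vars t `|` term_vars u
  | IRel _ a | INRel _ a => \bigcup_i term_vars (a i)
  | IInc _ a b => \bigcup_i (term_vars (a i) `|` term_vars (b i))
  | IAnd q r | IOr q r => ifv q `|` ifv r
  | IAll v q | IEx v q => ifv q `\ v
  end.

(* Assignments in a team are partial: s v = None when v is outside the domain
   of s. *)
Definition assignment (A : Type) := nat -> option A.
Definition team (A : Type) := set (assignment A).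

Definition has_domain A (X : team A) (V : set nat) :=
  forall s, X s -> [set v | isSome (s v)] = V.

Definition aupd A (s : assignment A) (v : nat) (m : A) : assignment A :=
  fun w => if w == v then Some m else s w.

Section TeamSemantics.
Variables (L : signature) (M : model L).

(* value s t d: all variables of t are in the domain of s, and t evaluates to
   d under s. *)
Fixpoint value (s : assignment M) (t : term L) : set M :=
  match t with
  | Var v => [set d | s v = Some d]
  | App f a => [set d | exists2 b, forall i, value s (a i) (b i) & d = funI b]
  end.

Definition values k (s : assignment M) (a : 'I_k -> term L) :
    set ('I_k -> M) :=
  [set d | forall i, value s (a i) (d i)].

Definition team_image k (X : team M) (a : 'I_k -> term L) : set ('I_k -> M) :=
  [set d | exists2 s, X s & values s a d].

Definition supplement (X : team M) (H : assignment M -> set M) (v : nat) :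
    team M :=
  [set s' | exists s m, [/\ X s, H s m & s' = aupd s v m]].

Definition duplicate (X : team M) (v : nat) : team M :=
  [set s' | exists s m, X s /\ s' = aupd s v m].

Fixpoint tsat (X : team M) (p : iformula L) : Prop :=
  match p with
  | IEq t u =>
      forall s, X s -> exists d e, [/\ value s t d, value s u e & d = e]
  | INeq t u =>
      forall s, X s -> exists d e, [/\ value s t d, value s u e & d <> e]
  | IRel r a => forall s, X s -> exists2 d, values s a d & relI d
  | INRel r a => forall s, X s -> exists2 d, values s a d & ~ relI d
  | IInc k a b => team_image X a `<=` team_image X b
  | IAnd q r => tsat X q /\ tsat X r
  | IOr q r => exists Y Z, [/\ X = Y `|` Z, tsat Y q & tsat Z r]
  | IAll v q => tsat (duplicate X v) q
  | IEx v q =>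
      exists2 H : assignment M -> set M,
        forall s, X s -> H s !=set0 & tsat (supplement X H v) q
  end.

End TeamSemantics.

(* Main.v *)
From Stdlib Require List.
From mathcomp Require Import all_boot.
From mathcomp Require Import boolp classical_sets filter.
Require Import Defs.

Set Implicit Arguments.
Unset Strict Implicit.
Unset Printing Implicit Defensive.

Local Open Scope classical_set_scope.

(** Let [win k (N, b) (M, a)] say that the second player survives k rounds of
    the back-and-forth game between N and M, where R need only be preserved
    from N to M. For finitely many symbols there is a formula [theta_k], positive
    in R, expressing that [(M, a)] is dominated in this sense by some [(N, b)]
    with [N |= phi] and [R b]; so phi entails [forall x (R x -> theta_k x)].
    If no k gave the converse, there would be models [A_k] of these myopic
    sentences and of [~ phi]. Take an ultraproduct of the [A_k] and, for every
    tuple a in R, of the corresponding [N_k], restricted to a countable set of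
    threads closed under Skolem functions and under answers in the game. By
    countability each ultraproduct of the [N_k] is isomorphic to that of the
    [A_k], by a map sending R to a subset [Q_a] of R containing a. Each [Q_a]
    satisfies phi and R is their union, so phi holds in the ultraproduct of the
    [A_k], a contradiction.

    In Inclusion Logic, [forall x (R x -> theta)] becomes
    [exists y (y <= x /\ theta')], with [R t] replaced by [t <= y]: if y ranges
    over all of R independently of the other variables, the subteams chosen
    for disjunctions and existential quantifiers still see all of R. *)

(** * Preliminaries *)

Lemma In_mem (T : eqType) (x : T) (s : seq T) : x \in s -> List.In x s.
Proof. by elim: s => //= y s IHs; rewrite in_cons => /orP[/eqP->|/IHs]; auto. Qed.

Lemma In_filter T (a : pred T) (s : seq T) x :
  List.In x (seq.filter a s) <-> List.In x s /\ a x.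
Proof.
elim: s => [|y s IHs] /=; first by tauto.
case: ifP => ay /=; rewrite IHs.
- by split=> [[<-|[]]|[[<-|]]]; auto.
- by split=> [[]|[[<-|]]]; rewrite ?ay; auto.
Qed.

(** Sublists play the role of subsets in the finite conjunctions and disjunctions of [finite_rank];
    only those cut out by a predicate matter. *)
Fixpoint sublists T (s : seq T) : seq (seq T) :=
  if s is x :: s' then sublists s' ++ map (cons x) (sublists s') else [:: [::]].

Lemma filter_sublists T (a : pred T) (s : seq T) :
  List.In (seq.filter a s) (sublists s).
Proof.
elim: s => [|x s IHs] /=; first by left.
by apply/List.in_app_iff; case: ifP => _; [right; apply/List.in_map|left].
Qed.

Lemma sublists_sub T (s t : seq T) x :
  List.In t (sublists s) -> List.In x t -> List.In x s.
Proof.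
elim: s t => [|y s IHs] t /=; first by case=> // <-.
move=> /List.in_app_iff[ts xt|/List.in_map_iff[u [<- us]] /=[]]; auto.
- by right; apply: IHs ts xt.
- by move=> xu; right; apply: IHs us xu.
Qed.

Definition point L (M : model L) : M :=
  proj1_sig (cid (let: inhabits m := dom_inhabited M in ex_intro (fun=> True) m I)).

Lemma eval_ext L (M : model L) (s s' : nat -> M) (t : term L) :
  (forall v, term_vars t v -> s v = s' v) -> eval s t = eval s' t.
Proof.
elim: t => [v|f a IHa] /= ss'; first exact: ss'.
by congr funI; apply/funext => i; apply: IHa => v tv; apply: ss'; exists i.
Qed.

Lemma sat_ext L (M : model L) (p : formula L) (s s' : nat -> M) :
  (forall v, fv p v -> s v = s' v) -> sat s p <-> sat s' p.
Proof.
elim: p s s' => [t u|r a|p IHp|p IHp q IHq|p IHp q IHq|p IHp q IHq|v p IHp|v p IHp]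
  s s' /= ss'.
- by rewrite (@eval_ext _ _ s s' t) ?(@eval_ext _ _ s s' u) // => v tv;
    apply: ss'; [right|left].
- suff -> : (fun i => eval s (a i)) = (fun i => eval s' (a i)) by [].
  by apply/funext => i; apply: eval_ext => v av; apply: ss'; exists i.
- by rewrite (IHp _ _ ss').
- by rewrite (IHp s s') ?(IHq s s') // => v pv; apply: ss'; [right|left].
- by rewrite (IHp s s') ?(IHq s s') // => v pv; apply: ss'; [right|left].
- by rewrite (IHp s s') ?(IHq s s') // => v pv; apply: ss'; [right|left].
- have E m : sat (upd s v m) p <-> sat (upd s' v m) p.
    apply: IHp => w pw; rewrite /upd; case: eqP => // wv.
    by apply: ss'; split.
  by split=> h m; apply/E.
- have E m : sat (upd s v m) p <-> sat (upd s' v m) p.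
    apply: IHp => w pw; rewrite /upd; case: eqP => // wv.
    by apply: ss'; split.
  by split=> -[m hm]; exists m; apply/E.
Qed.

Lemma models_sentence L (M : model L) (p : formula L) (s : nat -> M) :
  sentence p -> models M p <-> sat s p.
Proof.
move=> p0; split=> [|sp s']; first exact.
have ss' v : fv p v -> s v = s' v by rewrite p0.
exact: (proj1 (sat_ext ss')).
Qed.

Lemma bounded_ord m (P : 'I_m -> set nat) :
  (forall i, exists K, forall v, P i v -> v < K) ->
  exists K, forall i v, P i v -> v < K.
Proof.
move=> /choice[K PK]; exists (\max_i K i) => i v /PK vK.
by rewrite (leq_trans vK) // leq_bigmax.
Qed.

Lemma term_vars_bounded L (t : term L) :
  exists K, forall v, term_vars t v -> v < K.
Proof.
elim: t => [v|f a /bounded_ord[K aK]]; first by exists v.+1 => _ ->.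
by exists K => v [i _]; apply: aK.
Qed.

Lemma fv_bounded L (p : formula L) : exists K, forall v, fv p v -> v < K.
Proof.
have U (P Q : set nat) : (exists K, forall v, P v -> v < K) ->
    (exists K, forall v, Q v -> v < K) ->
    exists K, forall v, (P `|` Q) v -> v < K.
  move=> [K PK] [K' QK]; exists (maxn K K') => v [/PK|/QK] vK;
  by rewrite leq_max vK ?orbT.
have D (P : set nat) v : (exists K, forall v, P v -> v < K) ->
    exists K, forall w, (P `\ v) w -> w < K.
  by move=> [K PK]; exists K => w [/PK].
elim: p => [t u|r a|p IHp|p IHp q IHq|p IHp q IHq|p IHp q IHq|v p IHp|v p IHp] /=;
  do ?[exact: U|exact: D|by []].
- by apply: U; apply: term_vars_bounded.
- have [K aK] := bounded_ord (fun i => term_vars_bounded (a i)).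
  by exists K => v [i _]; apply: aK.
Qed.

(** * R-positive formulas and the back-and-forth game *)

Section PositiveFormulas.
Variables (L : signature) (n : nat).
Implicit Types A : model (add_rel L n).

(* Unnested literals. Positive graph literals suffice for function symbols,
   because the isomorphisms are total on both sides. *)
Inductive lit :=
| LEq of bool & nat & nat
| LFun (f : fsym L) of ('I_(far L f) -> nat) & nat
| LRel (b : bool) (r : rsym L) of ('I_(rar L r) -> nat)
| LR of ('I_n -> nat).

(* Variables are de Bruijn levels: at level m, a quantifier binds m. *)
Inductive pos :=
| PLit of lit
| PTrue
| PFalse
| PAnd of pos & pos
| POr of pos & pos
| PAll of pos
| PEx of pos.

Definition lit_holds A (s : nat -> A) (l : lit) : Prop :=
  match l with
  | LEq true i j => s i = s j
  | LEq false i j => s i <> s j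
  | LFun f a j => @funI _ A f (fun i => s (a i)) = s j
  | LRel true r a => @relI _ A (Some r) (fun i => s (a i))
  | LRel false r a => ~ @relI _ A (Some r) (fun i => s (a i))
  | LR a => @relI _ A None (fun i => s (a i))
  end.

Fixpoint pos_holds A m (s : nat -> A) (p : pos) : Prop :=
  match p with
  | PLit l => lit_holds s l
  | PTrue => True
  | PFalse => False
  | PAnd p q => pos_holds m s p /\ pos_holds m s q
  | POr p q => pos_holds m s p \/ pos_holds m s q
  | PAll p => forall c, pos_holds m.+1 (upd s m c) p
  | PEx p => exists c, pos_holds m.+1 (upd s m c) p
  end.

Definition lit_in (D : nat -> Prop) (l : lit) : Prop :=
  match l with
  | LEq _ i j => D i /\ D j
  | LFun _ a j => (forall i, D (a i)) /\ D j
  | LRel _ _ a => forall i, D (a i)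
  | LR a => forall i, D (a i)
  end.

Definition lit_scoped m := lit_in (fun v => v < m).

Definition lit_map (g : nat -> nat) (l : lit) : lit :=
  match l with
  | LEq b i j => LEq b (g i) (g j)
  | LFun f a j => LFun (fun i => g (a i)) (g j)
  | LRel b r a => LRel b (fun i => g (a i))
  | LR a => LR (fun i => g (a i))
  end.

Lemma lit_map_holds A (s : nat -> A) (s' : nat -> A) g D l : lit_in D l ->
  (forall v, D v -> s (g v) = s' v) ->
  lit_holds s (lit_map g l) <-> lit_holds s' l.
Proof.
move=> Dl E; have Ea m (a : 'I_m -> nat) : (forall i, D (a i)) ->
    (fun i => s (g (a i))) = (fun i => s' (a i)).
  by move=> Da; apply/funext => i; apply: E.
by case: l Dl => [[] i j [Di Dj]|f a j [/Ea h Dj]|[] r a /Ea h|a /Ea h] /=;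
  rewrite ?h ?E.
Qed.

Lemma lit_in_map (D D' : nat -> Prop) g l : lit_in D l ->
  (forall v, D v -> D' (g v)) -> lit_in D' (lit_map g l).
Proof.
by case: l => [? i j [Di Dj]|f a j [Da Dj]|? r a Da|a Da] h /=;
  do ?split; move=> *; apply: h.
Qed.

(** A literal has finitely many variables, so one stage of an increasing chain already contains them
    all. *)
Lemma lit_in_directed (D : nat -> nat -> Prop) l :
  (forall c c' v, c <= c' -> D c v -> D c' v) ->
  lit_in (fun v => exists c, D c v) l -> exists c, lit_in (D c) l.
Proof.
move=> Dle; have tup m (a : 'I_m -> nat) : (forall i, exists c, D c (a i)) ->
    exists c, forall i, D c (a i).
  move=> /choice[c cP]; exists (\max_i c i) => i; apply: Dle (cP i).
  exact: leq_bigmax.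
case: l => [? i j [[c Di] [c' Dj]]|f a j [/tup[c Da] [c' Dj]]|? r a /tup//|a /tup//].
  exists (maxn c c'); split; [apply: Dle Di|apply: Dle Dj];
  by rewrite ?leq_maxl ?leq_maxr.
exists (maxn c c'); split=> [i|]; [apply: Dle (Da i)|apply: Dle Dj];
by rewrite ?leq_maxl ?leq_maxr.
Qed.

Fixpoint scoped m (p : pos) : Prop :=
  match p with
  | PLit l => lit_scoped m l
  | PTrue | PFalse => True
  | PAnd p q | POr p q => scoped m p /\ scoped m q
  | PAll p | PEx p => scoped m.+1 p
  end.

Definition pconj := foldr PAnd PTrue.
Definition pdisj := foldr POr PFalse.

Lemma pconj_holds A m (s : nat -> A) S :
  pos_holds m s (pconj S) <-> forall p, List.In p S -> pos_holds m s p.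
Proof.
elim: S => [|p S IHS] /=; first by split.
rewrite IHS; split=> [[hp hS] q [<-|]|h]; auto.
Qed.

Lemma pdisj_holds A m (s : nat -> A) S :
  pos_holds m s (pdisj S) <-> exists2 p, List.In p S & pos_holds m s p.
Proof.
elim: S => [|p S IHS] /=; first by split=> // -[].
rewrite IHS; split=> [[hp|[q qS hq]]|[q [<-|qS] hq]].
- by exists p; auto.
- by exists q; auto.
- by left.
- by right; exists q.
Qed.

Lemma pconj_scoped m S : (forall p, List.In p S -> scoped m p) -> scoped m (pconj S).
Proof. by elim: S => //= p S IHS h; split; auto. Qed.

Lemma pdisj_scoped m S : (forall p, List.In p S -> scoped m p) -> scoped m (pdisj S).
Proof. by elim: S => //= p S IHS h; split; auto. Qed.

Definition lit_formula (l : lit) : formula (add_rel L n) :=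
  match l with
  | LEq true i j => FEq (Var i) (Var j)
  | LEq false i j => FNot (FEq (Var i) (Var j))
  | LFun f a j => FEq (@App (add_rel L n) f (fun i => Var (a i))) (Var j)
  | LRel true r a => @FRel (add_rel L n) (Some r) (fun i => Var (a i))
  | LRel false r a => FNot (@FRel (add_rel L n) (Some r) (fun i => Var (a i)))
  | LR a => @FRel (add_rel L n) None (fun i => Var (a i))
  end.

(** Truth and falsity bind a variable, so that they have no free variables even at level 0. *)
Fixpoint pos_formula m (p : pos) : formula (add_rel L n) :=
  match p with
  | PLit l => lit_formula l
  | PTrue => FAll m (FEq (Var m) (Var m))
  | PFalse => FEx m (FNot (FEq (Var m) (Var m)))
  | PAnd p q => FAnd (pos_formula m p) (pos_formula m q)
  | POr p q => FOr (pos_formula m p) (pos_formula m q)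
  | PAll p => FAll m (pos_formula m.+1 p)
  | PEx p => FEx m (pos_formula m.+1 p)
  end.

Lemma sat_pos_formula A m (s : nat -> A) p :
  sat s (pos_formula m p) <-> pos_holds m s p.
Proof.
elim: p m s => [[[] i j|f a j|[] r a|a]|||p IHp q IHq|p IHp q IHq|p IHp|p IHp]
  m s //=.
- by split=> // -[c].
- by rewrite IHp IHq.
- by rewrite IHp IHq.
- by split=> h c; apply/IHp.
- by split=> -[c h]; exists c; apply/IHp.
Qed.

Lemma polarity_pos_formula m p : polarity true (pos_formula m p).
Proof.
by elim: p m => [[[] i j|f a j|[] r a|a]|||p IHp q IHq|p IHp q IHq|p IHp|p IHp]
  m //=; rewrite IHp IHq.
Qed.

Lemma fv_pos_formula m p : scoped m p -> fv (pos_formula m p) `<=` [set v | v < m].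
Proof.
elim: p m => [[[] i j|f a j|[] r a|a]|||p IHp q IHq|p IHp q IHq|p IHp|p IHp] m /=.
- by move=> [im jm] v [->|->].
- by move=> [im jm] v [->|->].
- by move=> [am jm] v [[i _ ->]|->]; rewrite /= ?am.
- by move=> am v [i _ ->] /=.
- by move=> am v [i _ ->] /=.
- by move=> am v [i _ ->] /=.
- by move=> _ v [[]].
- by move=> _ v [[]].
- by move=> [/IHp hp /IHq hq] v [/hp|/hq].
- by move=> [/IHp hp /IHq hq] v [/hp|/hq].
- by move=> /IHp hp v [/hp/=]; rewrite ltnS leq_eqVlt => /orP[/eqP|].
- by move=> /IHp hp v [/hp/=]; rewrite ltnS leq_eqVlt => /orP[/eqP|].
Qed.

(** * The back-and-forth game and its finite ranks *)

Section Game.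
Variables (fs : seq (fsym L)) (rs : seq (rsym L)).

Definition lit_over (l : lit) : Prop :=
  match l with
  | LFun f _ _ => List.In f fs
  | LRel _ r _ => List.In r rs
  | _ => True
  end.

Lemma lit_over_map g l : lit_over (lit_map g l) <-> lit_over l.
Proof. by case: l. Qed.

Lemma finite_tuples k m : exists s : seq ('I_k -> nat),
  forall a, List.In a s <-> forall i, a i < m.
Proof.
exists [seq (fun i => val (g i)) | g : {ffun 'I_k -> 'I_m} <- enum {ffun 'I_k -> 'I_m}] => a.
rewrite List.in_map_iff; split=> [[g [<- _]] i|am]; first exact: ltn_ord.
exists [ffun i => Ordinal (am i)]; split.
  by apply/funext => i; rewrite ffunE.
by apply/In_mem; rewrite mem_enum.
Qed.

Lemma finite_lits m : exists s : seq lit,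
  forall l, List.In l s <-> lit_over l /\ lit_scoped m l.
Proof.
have [ev evP] : exists s : seq lit, forall l, List.In l s <->
    if l is LEq b i j then i < m /\ j < m else False.
  exists (List.flat_map (fun b => List.flat_map (fun i => map (LEq b i) (iota 0 m)) (iota 0 m)) [:: true; false]).
  have im i : List.In i (iota 0 m) <-> i < m.
    split=> [|im]; last by apply/In_mem; rewrite mem_iota.
    suff : forall x, List.In i (iota x m) -> i < x + m by exact.
    elim: (m) => //= k IHk x [<-|/IHk]; first by rewrite addnS ltnS leq_addr.
    by rewrite addSnnS.
  case=> [b i j|f a j|b r a|a]; rewrite List.in_flat_map; split=> //.
  - move=> [b' [_ /List.in_flat_map[i' [hi /List.in_map_iff[j' [[_ <- <-] hj]]]]]].
    by split; apply/im.
  - move=> [hi hj]; exists b; split; first by case: b => /=; auto.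
    by apply/List.in_flat_map; exists i; split; [apply/im|apply/List.in_map/im].
  - by move=> [b [_ /List.in_flat_map[i [_ /List.in_map_iff[j' []]]]]].
  - by move=> [b' [_ /List.in_flat_map[i [_ /List.in_map_iff[j' []]]]]].
  - by move=> [b [_ /List.in_flat_map[i [_ /List.in_map_iff[j' []]]]]].
have fun1 (f : fsym L) : exists s : seq lit, forall l, List.In l s <->
    (exists a j, l = @LFun f a j) /\ lit_scoped m l.
  have [T TP] := finite_tuples (far L f) m.
  have [s sP] := finite_tuples 1 m.
  exists (List.flat_map (fun a => map (fun j => @LFun f a (j ord0)) s) T) => l.
  rewrite List.in_flat_map; split.
    move=> [a [/TP aT /List.in_map_iff[j [<- /sP js]]]]; split; first by exists a, (j ord0).
    by split.
  move=> [[a [j ->]] [/= am jm]]; exists a; split; first exact/TP.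
  by apply/List.in_map_iff; exists (fun=> j); split => //; apply/sP.
have rel1 (r : rsym L) : exists s : seq lit, forall l, List.In l s <->
    (exists b a, l = @LRel b r a) /\ lit_scoped m l.
  have [T TP] := finite_tuples (rar L r) m.
  exists (map (@LRel true r) T ++ map (@LRel false r) T) => l.
  rewrite List.in_app_iff; split.
    by move=> [|] /List.in_map_iff[a [<- /TP am]]; split => //; eexists; exists a.
  by move=> [[[] [a ->]] /TP am]; [left|right]; apply/List.in_map.
have [funs funsP] := choice fun1; have [rels relsP] := choice rel1.
have [T TP] := finite_tuples n m.
exists (ev ++ List.flat_map funs fs ++ List.flat_map rels rs ++ map LR T) => l.
rewrite !List.in_app_iff !List.in_flat_map List.in_map_iff evP; split.
  move=> [|[[f [ff /funsP[[a [j ->]]]]]|[[r [rr /relsP[[b [a ->]]]]]|[a [<- /TP]]]]] //.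
  by case: l.
case: l => [b i j|f a j|b r a|a] /=; first by tauto.
- move=> [ff am]; right; left; exists f; split=> //; apply/funsP.
  by split=> //; exists a, j.
- move=> [rr am]; do 2 right; left; exists r; split=> //; apply/relsP.
  by split=> //; exists b, a.
- by move=> [_ am]; do 3 right; exists a; split => //; apply/TP.
Qed.

Section Win.
Variables N M : model (add_rel L n).
Implicit Type p : seq (N * M).

Definition lits_preserved p := forall l, lit_over l -> lit_scoped (size p) l ->
  lit_holds (nth (point N) (unzip1 p)) l -> lit_holds (nth (point M) (unzip2 p)) l.

(* The second player survives r rounds of the back-and-forth game from p, in
   which R only has to be preserved from N to M. *)
Fixpoint win r p : Prop :=
  lits_preserved p /\
  if r is r'.+1 then
    (forall c, exists d, win r' (rcons p (c, d))) /\
    (forall d, exists c, win r' (rcons p (c, d)))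
  else True.

Lemma winW r p : win r.+1 p -> win r p.
Proof.
elim: r p => [|r IHr] p [pp [h1 h2]]; first by [].
split=> //; split=> [c|d].
- by have [d /IHr] := h1 c; exists d.
- by have [c /IHr] := h2 d; exists c.
Qed.

Lemma win_le r r' p : r <= r' -> win r' p -> win r p.
Proof.
elim: r' => [|r' IHr']; first by rewrite leqn0 => /eqP->.
by rewrite leq_eqVlt => /orP[/eqP->//|]; rewrite ltnS => /IHr' h /winW.
Qed.

(** Take the answer for the largest [r <= k] such that [r.+1] rounds can be survived; [win_le]
    covers the smaller ones. A uniform answer is wanted because the k-th component of a thread is
    chosen before r is known. *)
Lemma win_forth k p c :
  exists d, forall r, r <= k -> win r.+1 p -> win r (rcons p (c, d)).
Proof.
elim: k => [|k [d dP]].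
  have [[_ [h _]]|W] := EM (win 1 p); last first.
    by exists (point M) => r; rewrite leqn0 => /eqP-> /W.
  by have [d hd] := h c; exists d => r; rewrite leqn0 => /eqP->.
have [[_ [h _]]|W] := EM (win k.+2 p).
  by have [d' hd] := h c; exists d' => r rk _; apply: win_le rk hd.
by exists d => r; rewrite leq_eqVlt => /orP[/eqP-> /W//|]; apply: dP.
Qed.

Lemma win_back k p d :
  exists c, forall r, r <= k -> win r.+1 p -> win r (rcons p (c, d)).
Proof.
elim: k => [|k [c cP]].
  have [[_ [_ h]]|W] := EM (win 1 p); last first.
    by exists (point N) => r; rewrite leqn0 => /eqP-> /W.
  by have [c hc] := h d; exists c => r; rewrite leqn0 => /eqP->.
have [[_ [_ h]]|W] := EM (win k.+2 p).
  by have [c' hc] := h d; exists c' => r rk _; apply: win_le rk hc.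
by exists c => r; rewrite leq_eqVlt => /orP[/eqP-> /W//|]; apply: cP.
Qed.

End Win.

Lemma upd_nth A (x : A) s c : upd (nth x s) (size s) c = nth x (rcons s c).
Proof.
apply/funext => i; rewrite /upd nth_rcons; case: ltngtP => // h.
by rewrite nth_default // ltnW.
Qed.

(** By induction on r: the literals, together with one existential and one universal formula for
    each subset of the formulas of the previous rank. Without negation, moves in N and in M call for
    different quantifiers. *)
Lemma finite_rank r m : exists F : seq pos,
  (forall q, List.In q F -> scoped m q) /\
  forall (N M : model (add_rel L n)) (p : seq (N * M)), size p = m ->
    (forall q, List.In q F -> pos_holds m (nth (point N) (unzip1 p)) q ->
       pos_holds m (nth (point M) (unzip2 p)) q) ->
    win r p.
Proof.
elim: r m => [|r IHr] m; have [ls lsP] := finite_lits m.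
  exists (map PLit ls); split=> [q /List.in_map_iff[l [<- /lsP[]]] //|].
  move=> N M p pm h; split=> // l lo ls' lN.
  by apply: (h (PLit l)) lN; apply/List.in_map/lsP; rewrite -pm.
have [F [Fm FP]] := IHr m.+1.
exists (map PLit ls ++ map (fun S => PEx (pconj S)) (sublists F)
         ++ map (fun S => PAll (pdisj S)) (sublists F)); split=> [q|].
  rewrite !List.in_app_iff !List.in_map_iff.
  move=> [[l [<- /lsP[]]]//|[] [S [<- SF]]].
  - by apply: pconj_scoped => p /(sublists_sub SF)/Fm.
  - by apply: pdisj_scoped => p /(sublists_sub SF)/Fm.
move=> N M p pm h; split.
  move=> l lo ls' lN; apply: (h (PLit l)) lN.
  by apply/List.in_app_iff; left; apply/List.in_map/lsP; rewrite -pm.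
have U1 c d : upd (nth (point N) (unzip1 p)) m c
    = nth (point N) (unzip1 (rcons p (c, d))).
  by rewrite /unzip1 map_rcons -upd_nth size_map pm.
have U2 c d : upd (nth (point M) (unzip2 p)) m d
    = nth (point M) (unzip2 (rcons p (c, d))).
  by rewrite /unzip2 map_rcons -upd_nth size_map pm.
split=> [c|d].
(* [S] collects what is true of c, so a witness d of [PEx (pconj S)] in M satisfies every formula of
   [F] that c satisfies. *)
- pose S := [seq q <- F | `[< pos_holds m.+1 (upd (nth (point N) (unzip1 p)) m c) q >]].
  have [d hd] : pos_holds m (nth (point M) (unzip2 p)) (PEx (pconj S)).
    apply: h; last by exists c; apply/pconj_holds => q /In_filter[_ /asboolP].
    rewrite !List.in_app_iff !List.in_map_iff; right; left; exists S.
    by split=> //; apply: filter_sublists.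
  exists d; apply: FP; first by rewrite size_rcons pm.
  move=> q qF; rewrite -(U1 c d) -(U2 c d) => hq.
  by move/pconj_holds: hd; apply; apply/In_filter; split=> //; apply/asboolP.
(* Dually, [S] collects what is false of d. So d refutes [PAll (pdisj S)] in M, hence it fails in N
   too, and a counterexample c falsifies all that d falsifies. *)
- pose S := [seq q <- F | ~~ `[< pos_holds m.+1 (upd (nth (point M) (unzip2 p)) m d) q >]].
  have [/(_ d)|] := EM (pos_holds m (nth (point M) (unzip2 p)) (PAll (pdisj S))).
    by move=> /pdisj_holds[q /In_filter[_ /asboolPn]].
  have hS : pos_holds m (nth (point N) (unzip1 p)) (PAll (pdisj S)) ->
      pos_holds m (nth (point M) (unzip2 p)) (PAll (pdisj S)).
    apply: h; rewrite !List.in_app_iff !List.in_map_iff; do 2 right; exists S.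
    by split=> //; apply: filter_sublists.
  move/(contra_not hS)/existsNP => [c hc].
  exists c; apply: FP; first by rewrite size_rcons pm.
  move=> q qF; rewrite -(U1 c d) -(U2 c d) => hq.
  apply: contrapT => nq; apply: hc; apply/pdisj_holds; exists q => //.
  by apply/In_filter; split=> //; apply/asboolPn.
Qed.

End Game.
End PositiveFormulas.

(** * Countable hulls and the restricted ultraproduct *)

(** The hull consists of the values of closed terms over [v0] and choice functions [op k]. Terms are
    coded as finite trees, and [e] decodes a number into a tree and evaluates it. *)
Lemma countable_hull (K : countType) V (Rel : K -> seq V -> V -> Prop) (v0 : V) :
  (forall k l, exists v, Rel k l v) ->
  exists e : nat -> V, forall k s, exists x, Rel k (map e s) (e x).
Proof.
move=> H; have [op opP] : exists op : K -> seq V -> V, forall k l, Rel k l (op k l).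
  by exists (fun k l => sval (cid (H k l))) => k l; case: cid.
pose fix ev (t : GenTree.tree nat) : V :=
  match t with
  | GenTree.Leaf _ => v0
  | GenTree.Node i ts => if unpickle i is Some k then op k (map ev ts) else v0
  end.
pose dec x := odflt (GenTree.Leaf 0) (unpickle x : option (GenTree.tree nat)).
exists (ev \o dec) => k s.
exists (pickle (GenTree.Node (pickle k) (map dec s))).
by rewrite /= /dec pickleK /= pickleK -map_comp; apply: opP.
Qed.

(** * The symbols and Skolem witnesses that a formula involves *)

Section Over.
Variables (L : signature).

Fixpoint term_over (fs : seq (fsym L)) (t : term L) : Prop :=
  match t with
  | Var _ => True
  | App f a => List.In f fs /\ forall i, term_over fs (a i)
  end.

(* qs lists the pairs (v, q) such that p needs a witness for "exists v, q". *)
Fixpoint over (fs : seq (fsym L)) (rs : seq (rsym L)) (qs : seq (nat * formula L))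
    (p : formula L) : Prop :=
  match p with
  | FEq t u => term_over fs t /\ term_over fs u
  | FRel r a => List.In r rs /\ forall i, term_over fs (a i)
  | FNot q => over fs rs qs q
  | FAnd q r | FOr q r | FImp q r => over fs rs qs q /\ over fs rs qs r
  | FAll v q => List.In (v, FNot q) qs /\ over fs rs qs q
  | FEx v q => List.In (v, q) qs /\ over fs rs qs q
  end.

Lemma term_over_sub fs fs' t :
  List.incl fs fs' -> term_over fs t -> term_over fs' t.
Proof. by move=> ff'; elim: t => //= f a IHa [/ff'? h]; split=> // i; apply: IHa. Qed.

Lemma over_sub fs fs' rs rs' qs qs' p :
  List.incl fs fs' -> List.incl rs rs' -> List.incl qs qs' ->
  over fs rs qs p -> over fs' rs' qs' p.
Proof.
move=> ff' rr' qq'.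
elim: p => [t u|r a|p IHp|p IHp q IHq|p IHp q IHq|p IHp q IHq|v p IHp|v p IHp] //=.
- by move=> [? ?]; split; apply: term_over_sub ff' _.
- by move=> [/rr'? h]; split=> // i; apply: term_over_sub ff' _.
- by move=> [/IHp ? /IHq].
- by move=> [/IHp ? /IHq].
- by move=> [/IHp ? /IHq].
- by move=> [/qq'? /IHp].
- by move=> [/qq'? /IHp].
Qed.

Lemma terms_over_ord m (a : 'I_m -> term L) :
  (forall i, exists fs, term_over fs (a i)) ->
  exists fs, forall i, term_over fs (a i).
Proof.
move=> /choice[fs fsP]; exists (List.flat_map fs (enum 'I_m)) => i.
apply: term_over_sub (fsP i) => f ff; apply/List.in_flat_map; exists i; split=> //.
by apply/In_mem; rewrite mem_enum.
Qed.

Lemma ex_term_over t : exists fs, term_over fs t.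
Proof.
elim: t => [v|f a /terms_over_ord[fs fsP]]; first by exists [::].
exists (f :: fs); split; first by left.
by move=> i; apply: term_over_sub (fsP i); apply: List.incl_tl (List.incl_refl _).
Qed.

Lemma ex_over p : exists fs rs qs, over fs rs qs p.
Proof.
have il T (s t : seq T) : List.incl s (s ++ t) by apply: List.incl_appl.
have ir T (s t : seq T) : List.incl t (s ++ t) by apply: List.incl_appr.
have two p1 p2 : (exists fs rs qs, over fs rs qs p1) ->
    (exists fs rs qs, over fs rs qs p2) ->
    exists fs rs qs, over fs rs qs p1 /\ over fs rs qs p2.
  move=> [fs [rs [qs h]]] [fs' [rs' [qs' h']]].
  by exists (fs ++ fs'), (rs ++ rs'), (qs ++ qs'); split;
    [apply: over_sub h|apply: over_sub h'].
have one p1 w : (exists fs rs qs, over fs rs qs p1) ->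
    exists fs rs qs, List.In w qs /\ over fs rs qs p1.
  move=> [fs [rs [qs h]]]; exists fs, rs, (w :: qs); split; first by left.
  by apply: over_sub h => // x; right.
elim: p => [t u|r a|p IHp|p IHp q IHq|p IHp q IHq|p IHp q IHq|v p IHp|v p IHp] /=;
  do ?[exact: two|exact: one|by []].
- have [[fs h] [fs' h']] := (ex_term_over t, ex_term_over u).
  by exists (fs ++ fs'), [::], [::]; split; [apply: term_over_sub h|apply: term_over_sub h'].
- have [fs fsP] := terms_over_ord (fun i => ex_term_over (a i)).
  by exists fs, [:: r], [::]; split=> //; left.
Qed.

End Over.

Section IsoSat.
Variables (L : signature) (B C : model L) (G : B -> C -> Prop).
Variables (fs : seq (fsym L)) (rs : seq (rsym L)).
Hypothesis G_total : forall b, exists c, G b c.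
Hypothesis G_onto : forall c, exists b, G b c.
Hypothesis G_eq : forall b c b' c', G b c -> G b' c' -> b = b' <-> c = c'.
Hypothesis G_fun : forall f b c, List.In f fs -> (forall i, G (b i) (c i)) ->
  G (@funI _ B f b) (@funI _ C f c).
Hypothesis G_rel : forall r b c, List.In r rs -> (forall i, G (b i) (c i)) ->
  @relI _ B r b <-> @relI _ C r c.

Lemma iso_eval t s s' : term_over fs t -> (forall v, G (s v) (s' v)) ->
  G (eval s t) (eval s' t).
Proof.
move=> + ss'; elim: t => [v _|f a IHa [ff h]] /=; first exact: ss'.
by apply: G_fun ff _ => i; apply/IHa/h.
Qed.

(** [G] is an isomorphism given as a relation. Totality and surjectivity carry quantifiers in both
    directions, so all formulas over the listed symbols are transferred, including negated ones. *)
Lemma iso_sat qs p s s' : over fs rs qs p -> (forall v, G (s v) (s' v)) ->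
  sat s p <-> sat s' p.
Proof.
have U (s0 : nat -> B) (s1 : nat -> C) v b c : (forall v, G (s0 v) (s1 v)) ->
    G b c -> forall w, G (upd s0 v b w) (upd s1 v c w).
  by move=> ss' bc w; rewrite /upd; case: eqP.
elim: p s s' => [t u|r a|p IHp|p IHp q IHq|p IHp q IHq|p IHp q IHq|v p IHp|v p IHp] s s' /=.
- by move=> [ot ou] ss'; apply: G_eq; apply: iso_eval.
- by move=> [rr oa] ss'; apply: G_rel => // i; apply: iso_eval.
- by move=> op ss'; rewrite (IHp s s').
- by move=> [op oq] ss'; rewrite (IHp s s') // (IHq s s').
- by move=> [op oq] ss'; rewrite (IHp s s') // (IHq s s').
- by move=> [op oq] ss'; rewrite (IHp s s') // (IHq s s').
- move=> [_ op] ss'; split=> h m.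
  + by have [b bm] := G_onto m; apply/(IHp _ _ op (U _ _ _ _ _ ss' bm)).
  + by have [c mc] := G_total m; apply/(IHp _ _ op (U _ _ _ _ _ ss' mc)).
- move=> [_ op] ss'; split=> -[m h].
  + have [c mc] := G_total m; exists c.
    by apply/(IHp _ _ op (U _ _ _ _ _ ss' mc)).
  + have [b bm] := G_onto m; exists b.
    by apply/(IHp _ _ op (U _ _ _ _ _ ss' bm)).
Qed.

End IsoSat.


(** * The ultraproduct restricted to countably many threads, and the theorem of Los *)

Section Quotient.
Variables (L : signature) (n : nat) (J : Type).
Variable St : J -> nat -> model (add_rel L n).
Variables (U : set_system nat) (UU : UltraFilter U).
Variable e : nat -> forall j k, St j k.

Definition eqv j x : set nat := [set y | U [set k | e x j k = e y j k]].

Lemma eqv_refl j x : eqv j x x.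
Proof. exact: filterS filterT. Qed.

Lemma eqv_sym j x y : eqv j x y -> eqv j y x.
Proof. by apply: filterS. Qed.

Lemma eqv_trans j x y z : eqv j x y -> eqv j y z -> eqv j x z.
Proof. by move=> xy yz; apply: filterS (filterI xy yz) => k /= [-> ->]. Qed.

Lemma eqv_eq j x y : eqv j x y -> eqv j x = eqv j y.
Proof.
move=> xy; apply/seteqP; split=> z; last exact: eqv_trans.
by apply: eqv_trans; apply: eqv_sym.
Qed.

(** Equivalent indices have equal classes, hence the same [xget]: this is a canonical
    representative, and the quotient is the subtype of its fixed points. *)
Definition rep j x := xget 0 (eqv j x).

Lemma eqv_rep j x : eqv j x (rep j x).
Proof. exact: (xgetI 0 (eqv_refl j x)). Qed.

Lemma rep_rep j x : rep j (rep j x) == rep j x.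
Proof. by rewrite /rep -(eqv_eq (eqv_rep j x)). Qed.

Definition qdom j := {x : nat | rep j x == x}.

Definition pi j x : qdom j := exist _ (rep j x) (rep_rep j x).

Lemma pi_val j (d : qdom j) : pi j (val d) = d.
Proof. by apply/val_inj => /=; apply/eqP/(valP d). Qed.

Lemma pi_eq j x y : pi j x = pi j y <-> U [set k | e x j k = e y j k].
Proof.
split=> [/(congr1 val)/= xy|/eqv_eq xy]; last by apply/val_inj; rewrite /= /rep xy.
by apply: eqv_trans (eqv_rep j x) _; rewrite xy; apply/eqv_sym/eqv_rep.
Qed.

Lemma val_pi j x : U [set k | e (val (pi j x)) j k = e x j k].
Proof. exact/eqv_sym/eqv_rep. Qed.

(** Only the symbols of L are interpreted here, so that different relations can later serve as R on
    the same structure. The default index 0 is taken when no thread names a function value; for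
    symbols in [fs], [ex_funI] excludes this. *)
Definition quot j : model L := @Model L (qdom j) (inhabits (pi j 0))
  (fun f a => pi j (xget 0 [set y |
     U [set k | @funI _ (St j k) f (fun i => e (val (a i)) j k) = e y j k]]))
  (fun r a => U [set k | @relI _ (St j k) (Some r) (fun i => e (val (a i)) j k)]).

Definition quot_R j : set ('I_n -> quot j) :=
  [set a | U [set k | @relI _ (St j k) None (fun i => e (val (a i)) j k)]].

Definition ultra j : model (add_rel L n) := expand (@quot_R j).

Lemma val_pi_all j m (x : 'I_m -> nat) : U [set k |
  (fun i => e (val (pi j (x i))) j k) = (fun i => e (x i) j k)].
Proof.
have /filterS : U [set k | forall i, e (val (pi j (x i))) j k = e (x i) j k].
  by apply: filter_forall => i; apply: val_pi.
by apply => k /= h; apply/funext.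
Qed.

Lemma U_iff (P Q : set nat) : U [set k | P k <-> Q k] -> U P <-> U Q.
Proof.
move=> PQ; split=> h; apply: filterS (filterI PQ h) => k /= [pq];
by apply pq.
Qed.

Lemma U_not (P : set nat) : ~ U P <-> U (~` P).
Proof.
split=> [|nP UP]; first by have [] := in_ultra_setVsetC P UU.
by apply: (filter_not_empty U); apply: filterS (filterI nP UP) => k [].
Qed.

Lemma ultra_rel j (r : rsym (add_rel L n)) (x : 'I_(rar _ r) -> nat) :
  @relI _ (ultra j) r (fun i => pi j (x i)) <->
  U [set k | @relI _ (St j k) r (fun i => e (x i) j k)].
Proof.
by case: r x => [r|] x /=; apply: U_iff;
  apply: filterS (val_pi_all j x) => k /= ->.
Qed.

Variables (fs : seq (fsym (add_rel L n))) (rs : seq (rsym (add_rel L n))).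
Variable qs : seq (nat * formula (add_rel L n)).
Hypothesis fs_qs : forall f, List.In f fs -> List.In
  (far L f, FEq (@App (add_rel L n) f (fun i => Var i)) (Var (far L f))) qs.
Hypothesis witness : forall v q, List.In (v, q) qs ->
  forall s : nat -> nat, exists x, forall j k,
    (exists m, sat (upd (fun w => e (s w) j k) v m) q) ->
    sat (upd (fun w => e (s w) j k) v (e x j k)) q.

(** Closure under functions is a case of Skolem closure: by [fs_qs], a witness is available for the
    variable [far L f] in the formula equating it with f of the preceding variables. *)
Lemma ex_funI j f (x : 'I_(far L f) -> nat) : List.In f fs ->
  exists y, forall k, @funI _ (St j k) f (fun i => e (x i) j k) = e y j k.
Proof.
move=> /fs_qs/witness/(_ (fun w => odflt 0 (omap x (insub w))))[y yP].
exists y => k; have := yP j k; rewrite /= /upd eqxx => h.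
have E m : (fun i : 'I_(far L f) => if val i == far L f then m else
    e (odflt 0 (omap x (insub (val i)))) j k) = (fun i => e (x i) j k).
  by apply/funext => i; rewrite valK /= ltn_eqF.
by rewrite E in h; apply: h; exists (@funI _ (St j k) f (fun i => e (x i) j k)); rewrite E.
Qed.

Lemma ultra_fun j f (x : 'I_(far L f) -> nat) y :
  U [set k | @funI _ (St j k) f (fun i => e (x i) j k) = e y j k] ->
  @funI _ (ultra j) f (fun i => pi j (x i)) = pi j y.
Proof.
move=> Uy /=; apply/pi_eq.
set S := (X in xget 0 X).
have : S y by apply: filterS (filterI Uy (val_pi_all j x)) => k /= [<- ->].
move=> /(xgetI 0); set z := xget 0 S => Sz.
by apply: filterS (filterI (filterI Uy (val_pi_all j x)) Sz) => k /= [[<- ->] <-].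
Qed.

Lemma los_term j (s : nat -> nat) (t : term (add_rel L n)) :
  term_over fs t -> exists x, @eval _ (ultra j) (fun w => pi j (s w)) t = pi j x /\
    U [set k | eval (fun w => e (s w) j k) t = e x j k].
Proof.
elim: t => [v _|f a IHa [ff oa]] /=.
  by exists (s v); split=> //; apply: filterS filterT.
have [x xP] := choice (fun i => IHa i (oa i)).
have [y yP] := ex_funI j x ff.
exists y; split.
  change (@funI _ (ultra j) f
    (fun i => @eval _ (ultra j) (fun w => pi j (s w)) (a i)) = pi j y).
  have -> : (fun i => @eval _ (ultra j) (fun w => pi j (s w)) (a i)) = (fun i => pi j (x i)).
    by apply/funext => i; have [] := xP i.
  by apply: ultra_fun; apply: filterS filterT => k _; apply: yP.
have /filterS : 
      U [set k | forall i, eval (fun w => e (s w) j k) (a i) = e (x i) j k].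
  by apply: filter_forall => i; have [] := xP i.
by apply => k /= h; rewrite -yP; congr funI; apply/funext.
Qed.

(** The quantifier cases need one thread that is a witness at U-many coordinates; [witness] provides
    it, for the negated body in the universal case. *)
Lemma los j (p : formula (add_rel L n)) (s : nat -> nat) : over fs rs qs p ->
  @sat _ (ultra j) (fun w => pi j (s w)) p <->
  U [set k | sat (fun w => e (s w) j k) p].
Proof.
have W (s0 : nat -> nat) (v : nat) q : List.In (v, q) qs ->
    U [set k | exists m, sat (upd (fun w => e (s0 w) j k) v m) q] ->
    exists x, U [set k | sat (upd (fun w => e (s0 w) j k) v (e x j k)) q].
  by move=> /witness/(_ s0)[x xP] h; exists x; apply: filterS h => k; apply: xP.
have E1 (s0 : nat -> nat) v x : @upd _ (ultra j) (fun w => pi j (s0 w)) v (pi j x)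
    = (fun w => pi j (if w == v then x else s0 w)).
  by apply/funext => w; rewrite /upd; case: ifP.
have E2 (s0 : nat -> nat) v x k : upd (fun w => e (s0 w) j k) v (e x j k)
    = (fun w => e (if w == v then x else s0 w) j k).
  by apply/funext => w; rewrite /upd; case: ifP.
elim: p s => [t u|r a|p IHp|p IHp q IHq|p IHp q IHq|p IHp q IHq|v p IHp|v p IHp] s /=.
- move=> [/(los_term j s)[x [-> Ux]] /(los_term j s)[y [-> Uy]]].
  by rewrite pi_eq; apply: U_iff; apply: filterS (filterI Ux Uy) => k /= [-> ->].
- move=> [_ oa]; have [x xP] := choice (fun i => los_term j s (oa i)).
  change (@relI _ (ultra j) r
    (fun i => @eval _ (ultra j) (fun w => pi j (s w)) (a i)) <->
    U [set k | relI (fun i => eval (fun w => e (s w) j k) (a i))]).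
  have -> : (fun i => @eval _ (ultra j) (fun w => pi j (s w)) (a i)) = (fun i => pi j (x i)).
    by apply/funext => i; have [] := xP i.
  apply: iff_trans (@ultra_rel j r x) _; apply: U_iff.
  have /filterS : 
      U [set k | forall i, eval (fun w => e (s w) j k) (a i) = e (x i) j k].
    by apply: filter_forall => i; have [] := xP i.
  apply => k /= h; suff -> : (fun i => eval (fun w => e (s w) j k) (a i))
    = (fun i => e (x i) j k) by [].
  exact/funext.
- by move=> op; rewrite (IHp s) // U_not.
- move=> [op oq]; rewrite (IHp s) // (IHq s) //; split=> [[hp hq]|h].
    exact: filterI.
  by split; apply: filterS h => k [].
- move=> [op oq]; rewrite (IHp s) // (IHq s) //; split=> [[]|h].
  + by apply: filterS => k; left.
  + by apply: filterS => k; right.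
  + apply: contrapT => /not_orP[/U_not np /U_not nq].
    apply: (filter_not_empty U).
    by apply: filterS (filterI h (filterI np nq)) => k /= [[hp|hq] []].
- move=> [op oq]; rewrite (IHp s) // (IHq s) //; split=> [h|h hp].
    apply: contrapT => /U_not nh; have /h hq : U [set k | sat (fun w => e (s w) j k) p].
      by apply: filterS nh => k /= /not_implyP[].
    apply: (filter_not_empty U).
    by apply: filterS (filterI hq nh) => k /= [hk /not_implyP[]].
  by apply: filterS (filterI h hp) => k /= [hk /hk].
- move=> [vq op]; split=> h.
    apply: contrapT => /U_not nh.
    have [|x] := W s _ _ vq; first by apply: filterS nh => k /= /existsNP.
    have := h (pi j x); rewrite E1 IHp // => h1 h2.
    apply: (filter_not_empty U); apply: filterS (filterI h1 h2) => k /= [h3].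
    by rewrite E2.
  move=> m; rewrite -(pi_val m) E1 IHp //; apply: filterS h => k /= h.
  by rewrite -E2.
- move=> [vq op]; split=> [[m]|/(W s _ _ vq)[x h]].
    rewrite -(pi_val m) E1 IHp //; apply: filterS => k /=; rewrite -E2.
    by exists (e (val m) j k).
  by exists (pi j x); rewrite E1 IHp //; apply: filterS h => k /=; rewrite E2.
Qed.

Lemma pi_congr j x y : e x j = e y j -> pi j x = pi j y.
Proof. by move=> xy; apply/pi_eq; rewrite xy; apply: filterS filterT. Qed.

(** * Isomorphisms between two restricted ultraproducts *)

Section Transfer.
Variables (j0 j1 : J) (G : nat -> Prop).
Hypothesis G_total : forall c, exists2 x, G x & e x j0 = e c j0.
Hypothesis G_onto : forall c, exists2 x, G x & e x j1 = e c j1.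
Hypothesis G_lit : forall l, @lit_over L n fs (pmap id rs) l -> lit_in G l ->
  U [set k | lit_holds (fun v => e v j0 k) l] ->
  U [set k | lit_holds (fun v => e v j1 k) l].

(** An index names an element in every quotient at once, so a set of indices [G] induces a relation
    between any two of them. *)
Definition G_iso (b : ultra j0) (c : ultra j1) :=
  exists x, [/\ G x, b = pi j0 x & c = pi j1 x].

(** The image of R under the isomorphism; this becomes the set [Q_a]. *)
Definition transfer_R : set ('I_n -> quot j1) :=
  [set c | exists2 b, quot_R b & forall i, G_iso (b i) (c i)].

(** Preserving equality makes the relation functional, preserving inequality makes it injective. *)
Lemma G_iso_eq b c b' c' : G_iso b c -> G_iso b' c' -> b = b' <-> c = c'.
Proof.
move=> [x [Gx -> ->]] [x' [Gx' -> ->]].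
split=> /pi_eq h; apply/pi_eq; first exact: (@G_lit (@LEq L n true x x')).
apply: contrapT => /U_not h'.
have /U_not := @G_lit (@LEq L n false x x') I (conj Gx Gx') h'; exact.
Qed.

Lemma transfer_R_sub : transfer_R `<=` @quot_R j1.
Proof.
move=> c [b Rb /choice[x xP]].
have bE : b = (fun i => pi j0 (x i)) by apply/funext => i; have [] := xP i.
have -> : c = (fun i => pi j1 (x i)) by apply/funext => i; have [] := xP i.
apply/(@ultra_rel j1 None x); refine (@G_lit (@LR L n x) I _ _).
  by move=> i; have [] := xP i.
by apply/(@ultra_rel j0 None x); rewrite bE in Rb.
Qed.

Lemma transfer_sat p s s' : over fs rs qs p -> (forall v, G_iso (s v) (s' v)) ->
  @sat _ (ultra j0) s p <-> @sat _ (expand transfer_R) s' p.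
Proof.
move=> op ss'; apply: (@iso_sat _ (ultra j0) (expand transfer_R) G_iso fs rs) op ss'.
- move=> b; have [x Gx E] := G_total (val b); exists (pi j1 x), x; split=> //.
  by rewrite -(pi_val b); apply/esym/pi_congr.
- move=> c; have [x Gx E] := G_onto (val c); exists (pi j0 x), x; split=> //.
  by rewrite -(pi_val c); apply/esym/pi_congr.
- exact: G_iso_eq.
- move=> f b c ff /choice[x xP].
  have -> : b = (fun i => pi j0 (x i)) by apply/funext => i; have [] := xP i.
  have -> : c = (fun i => pi j1 (x i)) by apply/funext => i; have [] := xP i.
  (* The index [y0] of the value need not lie in [G]; it is replaced by one in [G] with the same
     component at [j0], and then the graph literal carries the equation over to [j1]. *)
  have [y0 y0P] := ex_funI j0 x ff; have [y Gy E] := G_total y0.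
  have U0 : U [set k | @funI _ (St j0 k) f (fun i => e (x i) j0 k) = e y j0 k].
    by apply: filterS filterT => k _; rewrite /= y0P E.
  exists y; split=> //; first exact: ultra_fun.
  apply: (@ultra_fun j1 f x y); refine (@G_lit (@LFun L n f x y) ff _ U0); split=> //.
  by move=> i; have [] := xP i.
- move=> r b c rr /choice[x xP].
  have bE : b = (fun i => pi j0 (x i)) by apply/funext => i; have [] := xP i.
  have cE : c = (fun i => pi j1 (x i)) by apply/funext => i; have [] := xP i.
  (* For R, one direction is the definition of [transfer_R] and the other uses injectivity. For the
     other symbols, literals of both signs are preserved. *)
  case: r rr b c x xP bE cE => [r|] rr b c x xP bE cE; last first.
    split=> [Rb|[b' Rb' bc']].
      by exists b => // i; exists (x i).
    suff -> : b = b' by [].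
    apply/funext => i; apply/(G_iso_eq _ (bc' i)); last by [].
    by exists (x i).
  have rr' : List.In r (pmap id rs).
    elim: (rs) rr => //= -[r'|] rs' IH [//|/IH//]; last by right.
    by case=> ->; left.
  have Gx i : G (x i) by have [] := xP i.
  rewrite bE cE; apply: iff_trans (@ultra_rel j0 (Some r) x) _.
  apply: iff_sym; apply: iff_trans (@ultra_rel j1 (Some r) x) _.
  split=> h; last exact: (@G_lit (@LRel L n true r x)).
  apply: contrapT => /U_not h'.
  by have /U_not := @G_lit (@LRel L n false r x) rr' Gx h'; apply.
Qed.

End Transfer.

End Quotient.

(** The bookkeeping of a countable back-and-forth construction: [E x c] says that x settles the c-th
    task, which is done in passing from stage c to stage [c.+1]. *)
Lemma dovetail (Good : seq nat -> Prop) (E : nat -> nat -> Prop) P0 :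
  Good P0 ->
  (forall P c, Good P -> exists P', [/\ Good P', {subset P <= P'} &
     exists2 x, x \in P' & E x c]) ->
  exists f : nat -> seq nat, [/\ f 0 = P0, forall c, Good (f c),
    forall c c', c <= c' -> {subset f c <= f c'} &
    forall c, exists2 x, x \in f c.+1 & E x c].
Proof.
move=> G0 H.
have [step stepP] : exists step : seq nat -> nat -> seq nat, forall P c, Good P ->
    [/\ Good (step P c), {subset P <= step P c} &
     exists2 x, x \in step P c & E x c].
  have H' P c : exists P', Good P -> [/\ Good P', {subset P <= P'} &
     exists2 x, x \in P' & E x c].
    have [/(H P c)[P' h]|nG] := EM (Good P); first by exists P'.
    by exists P => /nG.
  by exists (fun P c => sval (cid (H' P c))) => P c; case: cid.
pose fix f c := if c is c'.+1 then step (f c') c' else P0.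
have fG c : Good (f c) by elim: c => //= c fG; have [] := stepP _ c fG.
exists f; split=> //.
- move=> c; elim=> [|c' IHc]; first by rewrite leqn0 => /eqP->.
  rewrite leq_eqVlt => /orP[/eqP->//|]; rewrite ltnS => /IHc h x /h.
  by have [_ + _] := stepP _ c' (fG c'); apply.
- by move=> c; have [] := stepP _ c (fG c).
Qed.

Lemma nth_map_enum m T (d : T) (f : 'I_m -> T) (i : 'I_m) :
  nth d [seq f i | i <- enum 'I_m] i = f i.
Proof. by rewrite (nth_map i) ?size_enum_ord // nth_ord_enum. Qed.

(** * Gluing the dominating structures *)

Section Amalgam.
Variables (L : signature) (n : nat) (phi : formula (add_rel L n)).
Hypothesis phi_sentence : sentence phi.
Hypothesis phi_closed : union_closed phi.
Variables (fs : seq (fsym (add_rel L n))) (rs : seq (rsym (add_rel L n))).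
Variable qs : seq (nat * formula (add_rel L n)).
Hypothesis phi_over : over fs rs qs phi.
Hypothesis fs_qs : forall f : fsym L, List.In f fs -> List.In
  (far L f, FEq (@App (add_rel L n) f (fun i => Var i)) (Var (far L f))) qs.

(** [pmap id] removes R, that is [None], from [rs], so R enters the game only through the positive
    literal [LR]. *)
Let game := @win L n fs (pmap id rs).
Arguments game {N M} r p.

Variable A : nat -> model (add_rel L n).
Variable N : forall k, ('I_n -> A k) -> model (add_rel L n).
Variable b : forall k (a : 'I_n -> A k), 'I_n -> N a.
Hypothesis N_phi : forall k (a : 'I_n -> A k), @relI _ (A k) None a ->
  [/\ models (N a) phi, @relI _ (N a) None (b a) &
      game k [seq (b a i, a i) | i <- enum 'I_n]].

(** [None] indexes the structures [A k]; every tuple of threads through them indexes a sequence of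
    structures [N]. *)
Definition index_type := option ('I_n -> forall k, A k).

Definition family (j : index_type) (k : nat) : model (add_rel L n) :=
  if j is Some a then N (fun i => a i k) else A k.

(* A thread has a component in every structure of the family, so that one
   sequence of threads is a position in all the games at once. *)
Definition thread := forall j k, family j k.
Definition thread0 : thread := fun j k => point (family j k).

Variables (U : set_system nat) (UU : UltraFilter U).
Hypothesis U_oo : \oo `<=` U.

Definition position a (p : seq thread) k : seq (family (Some a) k * A k) :=
  [seq (x (Some a) k, x None k) | x <- p].

(** At a single coordinate only finitely many rounds may be guaranteed; the limit needs each r at
    almost all coordinates. *)
Definition safe a p := forall r, U [set k | game r (position a p k)].

(** The first n entries of a position determine a. An answer in A is one component shared by all a,
    so it has to know which game it belongs to; answers in the [N a] are separate components. *)
Definition tuple_of (p : seq thread) : 'I_n -> forall k, A k :=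
  fun i => nth thread0 p i None.

(** The round spent is paid for by safety at [r.+1], and the restriction [r <= k] excludes only
    finitely many k. *)
Lemma safe_rcons a p (x : thread) : safe a p ->
  (forall k r, r <= k -> game r.+1 (position a p k) ->
     game r (rcons (position a p k) (x (Some a) k, x None k))) ->
  safe a (rcons p x).
Proof.
move=> sp h r; have Ur : U [set k | r <= k] by apply: U_oo; exists r.
apply: filterS (filterI Ur (sp r.+1)) => k /= [rk hk].
by rewrite /position map_rcons; apply: h.
Qed.

(* The four kinds of threads needed in the hull: Skolem witnesses, starting
   pairs (b_i, a_i), and answers to a move in [N a] or in A. In the last three
   cases the component on the side of the move is copied from the argument. *)
Definition closure_rel (kd : nat + ('I_n + bool))
    (l : seq thread) (x : thread) : Prop :=
  match kd with
  | inl i => forall v q, List.nth_error qs i = Some (v, q) -> forall j k,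
      (exists m, sat (upd (fun w => nth thread0 l w j k) v m) q) ->
      sat (upd (fun w => nth thread0 l w j k) v (x j k)) q
  | inr (inl i) => x None = head thread0 l None /\
      forall a k, x (Some a) k = b (fun i => a i k) i
  | inr (inr true) => (forall a, x (Some a) = head thread0 l (Some a)) /\
      (safe (tuple_of (behead l)) (behead l) ->
       safe (tuple_of (behead l)) (rcons (behead l) x))
  | inr (inr false) => x None = head thread0 l None /\
      forall a, safe a (behead l) -> safe a (rcons (behead l) x)
  end.

Lemma closure_rel_total kd l : exists x, closure_rel kd l x.
Proof.
case: kd => [i|[i|[]]] /=.
- case E : (List.nth_error qs i) => [[v q]|]; last by exists thread0.
  have H j k : exists y : family j k,
      (exists m, sat (upd (fun w => nth thread0 l w j k) v m) q) ->
      sat (upd (fun w => nth thread0 l w j k) v y) q.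
    have [[m h]|nh] := EM (exists m, sat (upd (fun w => nth thread0 l w j k) v m) q).
      by exists m.
    by exists (point _) => /nh.
  by exists (fun j k => sval (cid (H j k))) => _ _ [<- <-] j k; case: cid.
- exists (fun j => match j return forall k, family j k with
    | None => head thread0 l None
    | Some a => fun k => b (fun i => a i k) i end).
  by split.
- set p := behead l; set c := head thread0 l; set a := tuple_of p.
  pose H k := cid (@win_forth L n fs (pmap id rs) (family (Some a) k) (A k)
    k (position a p k) (c (Some a) k)).
  exists (fun j => match j return forall k, family j k with
    | None => fun k => sval (H k)
    | Some a' => c (Some a') end).
  by split=> // sp; apply: safe_rcons => // k; case: (H k).
- set p := behead l; set d := head thread0 l.
  pose H a k := cid (@win_back L n fs (pmap id rs) (family (Some a) k) (A k)
    k (position a p k) (d None k)).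
  exists (fun j => match j return forall k, family j k with
    | None => d None
    | Some a => fun k => sval (H a k) end).
  by split=> // a sp; apply: safe_rcons => // k; case: (H a k).
Qed.

Variable e : nat -> thread.
Hypothesis e_closed : forall kd s, exists x, closure_rel kd (map e s) (e x).

Lemma e_witness v q : List.In (v, q) qs ->
  forall s : nat -> nat, exists x, forall j k,
    (exists m, sat (upd (fun w => e (s w) j k) v m) q) ->
    sat (upd (fun w => e (s w) j k) v (e x j k)) q.
Proof.
move=> /(@List.In_nth_error _ _ _)[i iE] s; have [K qK] := fv_bounded q.
(* The free variables of q lie below [K], so a finite initial part of the assignment s suffices. *)
have [x /(_ _ _ iE) xP] := e_closed (inl i) (map s (iota 0 K)).
exists x => j k; have E m : sat (upd (fun w => nth thread0 (map e (map s (iota 0 K))) w j k) v m) q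
    <-> sat (upd (fun w => e (s w) j k) v m) q.
  apply: sat_ext => w /qK wK; rewrite /upd; case: eqP => // _.
  by rewrite -map_comp (nth_map 0) ?size_iota //= nth_iota.
by move=> [m /E hm]; apply/E/xP; exists m.
Qed.

Section Tuple.
Variable y : 'I_n -> nat.
Let a : 'I_n -> forall k, A k := fun i => e (y i) None.
Hypothesis Ua : U [set k | @relI _ (A k) None (fun i => a i k)].

(** At coordinate k the starting pairs survive k rounds, hence r rounds for all [k >= r]. *)
Lemma start : exists x0 : 'I_n -> nat,
  [/\ forall i, e (x0 i) None = a i, forall i k, e (x0 i) (Some a) k = b (fun i => a i k) i &
      safe a (map e [seq x0 i | i <- enum 'I_n])].
Proof.
have [x0 x0P] := choice (fun i => e_closed (inr (inl i)) [:: y i]).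
exists x0; split=> [i|i k|r]; [by have [] := x0P i|by have [_ ->] := x0P i|].
have E k : position a (map e [seq x0 i | i <- enum 'I_n]) k =
    [seq (b (fun i => a i k) i : family (Some a) k, a i k) | i <- enum 'I_n].
  rewrite /position -!map_comp; apply: eq_map => i /=.
  by have [xE ->] := x0P i; rewrite xE.
have Ur : U [set k | r <= k] by apply: U_oo; exists r.
apply: filterS (filterI Ur Ua) => k /= [rk /N_phi[_ _]].
by rewrite E; apply: win_le rk.
Qed.

(** The bound [n <= size P] keeps [tuple_of] unchanged when further threads are appended. *)
Let good P := [/\ safe a (map e P), tuple_of (map e P) = a & n <= size P].

Lemma good_rcons P x : good P -> safe a (map e (rcons P x)) -> good (rcons P x).
Proof.
move=> [_ tP nP] sP; split=> //; last by rewrite size_rcons ltnW.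
rewrite -tP; apply/funext => i; rewrite /tuple_of map_rcons nth_rcons size_map.
by rewrite (leq_trans (ltn_ord i)).
Qed.

(** Task c concerns thread [c./2]: a move in [N a] for even c, in A for odd c. The list given to
    [e_closed] has the moved thread at its head and the position behind it. *)
Lemma good_extend P c : good P -> exists P', [/\ good P', {subset P <= P'} &
  exists2 x, x \in P' & if odd c then e x None = e c./2 None
                        else e x (Some a) = e c./2 (Some a)].
Proof.
move=> gP; have [sP tP nP] := gP.
have [x [xc sx]] : exists x, (if odd c then e x None = e c./2 None
    else e x (Some a) = e c./2 (Some a)) /\ safe a (map e (rcons P x)).
  case: (odd c).
    have [x [/= h1 h2]] := e_closed (inr (inr false)) (c./2 :: P).
    by exists x; rewrite map_rcons; split=> //; apply: h2.
  have [x [/= h1 h2]] := e_closed (inr (inr true)) (c./2 :: P).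
  by exists x; rewrite map_rcons; split=> //; rewrite -{1}tP; apply: h2; rewrite tP.
exists (rcons P x); split; first exact: good_rcons.
- by move=> z; rewrite mem_rcons in_cons => ->; rewrite orbT.
- by exists x => //; rewrite mem_rcons mem_head.
Qed.

(** Zero rounds already preserve literals. Variables, here indices of threads, are first renamed to
    their places in P, as the game reads positions through [nth]. *)
Lemma good_lit P l : good P -> @lit_over L n fs (pmap id rs) l ->
  lit_in (fun v => v \in P) l ->
  U [set k | lit_holds (fun v => e v (Some a) k) l] ->
  U [set k | lit_holds (fun v => e v None k) l].
Proof.
move=> [sP _ _] ol lP Ul; apply: filterS (filterI (sP 0) Ul) => k /= [[+ _]].
move=> /(_ (lit_map (index^~ P) l)); rewrite lit_over_map => /(_ ol).
have sl : lit_scoped (size (position a (map e P) k)) (lit_map (index^~ P) l).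
  by apply: lit_in_map lP _ => v vP; rewrite !size_map index_mem.
move=> /(_ sl) h hl.
have E1 v : v \in P -> nth (point (family (Some a) k))
    (unzip1 (position a (map e P) k)) (index v P) = e v (Some a) k.
  move=> vP; rewrite /unzip1 /position -!map_comp (nth_map 0) ?index_mem //=.
  by rewrite nth_index.
have E2 v : v \in P -> nth (point (A k))
    (unzip2 (position a (map e P) k)) (index v P) = e v None k.
  move=> vP; rewrite /unzip2 /position -!map_comp (nth_map 0) ?index_mem //=.
  by rewrite nth_index.
by apply/(lit_map_holds lP E2)/h/(lit_map_holds lP E1).
Qed.

Lemma amalgam_tuple : exists Q : set ('I_n -> quot UU e None),
  [/\ Q `<=` @quot_R _ _ _ _ _ UU e None, Q (fun i => pi UU e None (y i)) &
      models (expand Q) phi].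
Proof.
have [x0 [x0a x0b sx0]] := start.
have gx0 : good [seq x0 i | i <- enum 'I_n].
  split=> //; last by rewrite size_map size_enum_ord.
  by apply/funext => i; rewrite /tuple_of -map_comp nth_map_enum /= x0a.
have [f [f0 fg fle fE]] := dovetail gx0 good_extend.
(* The union of the stages. Even tasks make it total on the [N a] side, odd ones on the A side. *)
pose G x := exists c, x \in f c.
have G_total c : exists2 x, G x & e x (Some a) = e c (Some a).
  have [x xf] := fE c.*2; rewrite odd_double doubleK => E.
  by exists x => //; exists c.*2.+1.
have G_onto c : exists2 x, G x & e x None = e c None.
  have [x xf] := fE c.*2.+1; rewrite /= odd_double /= uphalf_double => E.
  by exists x => //; exists c.*2.+2.
have G_lit l : @lit_over L n fs (pmap id rs) l -> lit_in G l ->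
    U [set k | lit_holds (fun v => e v (Some a) k) l] ->
    U [set k | lit_holds (fun v => e v None k) l].
  move=> ol /lit_in_directed[c c' v cc'|c lc]; first exact: fle.
  exact: good_lit (fg c) ol lc.
exists (@transfer_R _ _ _ _ _ UU e (Some a) None G); split.
- exact: transfer_R_sub G_lit.
- exists (fun i => pi UU e (Some a) (x0 i)).
    apply/(@ultra_rel _ _ _ _ _ UU e (Some a) None x0).
    apply: filterS Ua => k /N_phi[_ + _].
    have <- : (fun i => e (x0 i) (Some a) k : family (Some a) k) = b (fun i => a i k).
      by apply/funext => i; apply: x0b.
    by [].
  move=> i; exists (x0 i); split=> //; last by apply: pi_congr; rewrite x0a.
  by exists 0; rewrite f0; apply: map_f; rewrite mem_enum.
- have [x Gx _] := G_total 0.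
  pose s0 : nat -> ultra UU e (Some a) := fun=> pi UU e (Some a) x.
  pose s1 : nat -> expand (@transfer_R _ _ _ _ _ UU e (Some a) None G)
    := fun=> pi UU e None x.
  apply/(models_sentence s1 phi_sentence).
  have s01 v : @G_iso _ _ _ _ _ UU e (Some a) None G (s0 v) (s1 v) by exists x.
  apply/(transfer_sat fs_qs e_witness G_total G_onto G_lit phi_over s01).
  apply/(los UU fs_qs e_witness (Some a) (fun=> x) phi_over).
  by apply: filterS Ua => k /N_phi[+ _ _]; apply.
Qed.

End Tuple.

(** Union closure is applied to the family indexed by the tuples in R; when R is empty, this is the
    empty family. *)
Lemma amalgam : U [set k | models (A k) phi].
Proof.
have H (d : {d : 'I_n -> quot UU e None | quot_R d}) : exists Q : set ('I_n -> quot UU e None),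
  [/\ Q `<=` @quot_R _ _ _ _ _ UU e None, Q (sval d) & models (expand Q) phi].
  case: d => d Rd; have [Q [QR Qd Qphi]] := amalgam_tuple Rd.
  exists Q; split=> //=; suff -> : d = (fun i => pi UU e None (val (d i))) by [].
  by apply/funext => i; rewrite pi_val.
have [Q QP] := choice H.
have : models (expand (\bigcup_i Q i)) phi.
  by apply: phi_closed => i; have [] := QP i.
have -> : \bigcup_i Q i = @quot_R _ _ _ _ _ UU e None.
  apply/seteqP; split=> [d [i _]|d Rd]; first by have [+ _ _] := QP i; apply.
  by exists (exist _ d Rd) => //; have [] := QP (exist _ d Rd).
move=> /(_ (fun=> pi UU e None 0)) /(los UU fs_qs e_witness None (fun=> 0) phi_over).
by apply: filterS => k /= /(models_sentence _ phi_sentence).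
Qed.

End Amalgam.

(** * The myopic equivalent of a union-closed sentence *)

Lemma pos_holds_ext L n (A : model (add_rel L n)) m (s s' : nat -> A) p :
  scoped m p -> (forall v, v < m -> s v = s' v) ->
  pos_holds m s p <-> pos_holds m s' p.
Proof.
move=> /fv_pos_formula pm ss'; rewrite -!sat_pos_formula.
by apply: sat_ext => v /pm; apply: ss'.
Qed.

Lemma union_closed_pos L n (phi : formula (add_rel L n)) :
  sentence phi -> union_closed phi ->
  exists2 theta : pos L n, scoped n theta &
    forall A : model (add_rel L n), models A phi <->
      forall s : nat -> A, @relI _ A None (fun i => s i) -> pos_holds n s theta.
Proof.
move=> sphi cphi; have [fs [rs [qs0 ophi0]]] := ex_over phi.
(* The graph formulas of the symbols in [fs] are added to the Skolem demands of phi, so that threads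
   are closed under functions. *)
pose qs := qs0 ++ [seq (far L f, FEq (@App (add_rel L n) f (fun i => Var i))
  (Var (far L f))) | f <- fs].
have ophi : over fs rs qs phi.
  by apply: over_sub ophi0 => //; apply/List.incl_appl/List.incl_refl.
have fs_qs f : List.In f fs -> List.In (far L f,
    FEq (@App (add_rel L n) f (fun i => Var i)) (Var (far L f))) qs.
  by move=> ff; apply/List.in_app_iff; right; apply/List.in_map_iff; exists f.
have [F FP] := choice (fun k => @finite_rank L n fs (pmap id rs) k n).
pose valid S := forall (A : model (add_rel L n)) (s : nat -> A),
  models A phi -> @relI _ A None (fun i => s i) -> pos_holds n s (pdisj S).
(* The strongest positive rank-k consequence of phi for tuples in R, in conjunctive normal form. *)
pose theta k := pconj (map (@pdisj L n) [seq S <- sublists (F k) | `[<valid S>]]).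
have theta_scoped k : scoped n (theta k).
  apply: pconj_scoped => _ /List.in_map_iff[S [<- /In_filter[SF _]]].
  by apply: pdisj_scoped => p /(sublists_sub SF); apply: (FP k).1.
have phi_theta k (A : model (add_rel L n)) : models A phi ->
    forall s : nat -> A, @relI _ A None (fun i => s i) -> pos_holds n s (theta k).
  move=> Aphi s Rs; apply/pconj_holds => _ /List.in_map_iff[S [<- /In_filter[_]]].
  by move=> /asboolP; apply.
apply: contrapT => none.
have cex k : exists A : model (add_rel L n),
    (forall s : nat -> A, @relI _ A None (fun i => s i) -> pos_holds n s (theta k)) /\
    ~ models A phi.
  apply: contrapT => nA; apply: none; exists (theta k) => // A.
  split=> [|h]; first exact: phi_theta.
  by apply: contrapT => nphi; apply: nA; exists A.
have [A AP] := choice cex.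
have HN k (a : 'I_n -> A k) : exists Nb : {N : model (add_rel L n) & 'I_n -> N},
    @relI _ (A k) None a ->
    [/\ models (projT1 Nb) phi, @relI _ (projT1 Nb) None (projT2 Nb) &
        @win L n fs (pmap id rs) (projT1 Nb) (A k) k
          [seq (projT2 Nb i, a i) | i <- enum 'I_n]].
  have [Ra|nRa] := EM (@relI _ (A k) None a); last first.
    (* Outside R a dummy value makes the choice total. *)
    by exists (existT (fun N : model (add_rel L n) => 'I_n -> N) (A k) a) => /nRa.
  pose sa := nth (point (A k)) [seq a i | i <- enum 'I_n].
  (* The disjunction of all rank-k formulas false at a cannot be valid, since [theta k] holds at a.
     A model of phi refuting it at a tuple in R satisfies there only rank-k formulas that are true
     at a. *)
  pose S := [seq q <- F k | ~~ `[< pos_holds n sa q >]].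
  have /existsNP[B /existsNP[s]] : ~ valid S.
    move=> vS; have := (AP k).1 sa.
    have -> : (fun i : 'I_n => sa i) = a.
      by apply/funext => i; apply: nth_map_enum.
    move=> /(_ Ra)/pconj_holds/(_ (pdisj S)) h.
    have /h/pdisj_holds[q /In_filter[_ /asboolPn]//] : List.In (pdisj S)
        (map (@pdisj L n) [seq S <- sublists (F k) | `[<valid S>]]).
    by apply/List.in_map/In_filter; split; [apply: filter_sublists|apply/asboolP].
  move=> /not_implyP[Bphi /not_implyP[Rs nS]].
  exists (existT (fun N : model (add_rel L n) => 'I_n -> N) B (fun i => s i)).
  split=> //=; apply: (FP k).2; first by rewrite size_map size_enum_ord.
  have -> : unzip1 [seq (s (val i), a i) | i <- enum 'I_n]
      = [seq s (val i) | i <- enum 'I_n].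
    by rewrite /unzip1 -map_comp.
  have -> : unzip2 [seq (s (val i), a i) | i <- enum 'I_n] = [seq a i | i <- enum 'I_n].
    by rewrite /unzip2 -map_comp.
  move=> q qF hq.
  apply: contrapT => nq; apply: nS; apply/pdisj_holds; exists q.
    by apply/In_filter; split=> //; apply/asboolPn.
  refine (proj1 (pos_holds_ext ((FP k).1 q qF) _) hq) => v vn.
  exact: (nth_map_enum (point B) (fun i : 'I_n => s i) (Ordinal vn)).
have [UF [UU U_oo]] := ultraFilterLemma eventually_filter.
pose Nb k a := sval (cid (HN k a)).
have NbP k (a : 'I_n -> A k) : @relI _ (A k) None a ->
    [/\ models (projT1 (Nb k a)) phi, @relI _ (projT1 (Nb k a)) None (projT2 (Nb k a)) &
        @win L n fs (pmap id rs) (projT1 (Nb k a)) (A k) k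
          [seq (projT2 (Nb k a) i, a i) | i <- enum 'I_n]].
  by rewrite /Nb; case: cid.
pose N k a := projT1 (Nb k a); pose b k a : 'I_n -> N k a := projT2 (Nb k a).
have [e eP] := countable_hull (thread0 N) (closure_rel_total fs rs qs b UU U_oo).
have := amalgam sphi cphi ophi fs_qs NbP UU U_oo eP.
move=> h; apply: (filter_not_empty UF); apply: filterS h => k /=.
by have [_] := AP k.
Qed.

Lemma sat_forall_tuple L (M : model L) n (x : 'I_n -> nat) (p : formula L) :
  (forall s : nat -> M, sat s (forall_tuple x p)) <-> forall s : nat -> M, sat s p.
Proof.
rewrite /forall_tuple; elim: (map _ _) => [//|v l IHl] /=; rewrite -IHl.
split=> h s; last by move=> m; apply: h.
have := h s (s v); congr sat; apply/funext => w; rewrite /upd.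
by case: eqP => [->|].
Qed.

(** * Translation into Inclusion Logic *)

Section InclusionLogic.
Variables (L : signature) (n : nat).
Variables (g : nat -> nat) (K : nat).
Hypothesis g_inj : injective g.
Hypothesis g_fresh : forall j, ~~ (K <= g j < K + n).

(** The variables y. Level j is named [g j], which avoids this block. *)
Definition fresh_vars : 'I_n -> term L := fun i => Var (K + i).

Definition lit_iformula (l : lit L n) : iformula L :=
  match l with
  | LEq true i j => IEq (Var (g i)) (Var (g j))
  | LEq false i j => INeq (Var (g i)) (Var (g j))
  | LFun f a j => IEq (App (fun i => Var (g (a i)))) (Var (g j))
  | LRel true r a => IRel (fun i => Var (g (a i)))
  | LRel false r a => INRel (fun i => Var (g (a i)))
  | LR a => IInc (fun i => Var (g (a i))) fresh_vars
  end.

Fixpoint pos_iformula m (p : pos L n) : iformula L :=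
  match p with
  | PLit l => lit_iformula l
  | PTrue => IAll (g m) (IEq (Var (g m)) (Var (g m)))
  | PFalse => IEx (g m) (INeq (Var (g m)) (Var (g m)))
  | PAnd p q => IAnd (pos_iformula m p) (pos_iformula m q)
  | POr p q => IOr (pos_iformula m p) (pos_iformula m q)
  | PAll p => IAll (g m) (pos_iformula m.+1 p)
  | PEx p => IEx (g m) (pos_iformula m.+1 p)
  end.

Lemma ifv_pos_iformula m p : scoped m p -> ifv (pos_iformula m p) `<=`
  [set v | (exists2 j, j < m & v = g j) \/ K <= v < K + n].
Proof.
have D m0 (P : set nat) :
    P `<=` [set v | (exists2 j, j < m0.+1 & v = g j) \/ K <= v < K + n] ->
    P `\ g m0 `<=` [set v | (exists2 j, j < m0 & v = g j) \/ K <= v < K + n].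
  move=> PS v [/PS[[j jm ->]|]] vm; last by right.
  left; exists j => //; move: jm; rewrite ltnS leq_eqVlt => /orP[/eqP jm|//].
  by case: vm; rewrite /= jm.
have G m0 j : j < m0 -> exists2 i, i < m0 & g j = g i by exists j.
elim: p m => [[[] i j|f a j|[] r a|a]|||p IHp q IHq|p IHp q IHq|p IHp|p IHp] m /=.
- by move=> [im jm] v [->|->]; left; apply: G.
- by move=> [im jm] v [->|->]; left; apply: G.
- by move=> [am jm] v [[i _ ->]|->]; left; apply: G.
- by move=> am v [i _ ->]; left; apply: G.
- by move=> am v [i _ ->]; left; apply: G.
- move=> am v [i _ [->|->]]; first by left; apply: G.
  by right; rewrite leq_addr ltn_add2l ltn_ord.
- by move=> _ v [[]].
- by move=> _ v [[]].
- by move=> [/IHp hp /IHq hq] v [/hp|/hq].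
- by move=> [/IHp hp /IHq hq] v [/hp|/hq].
- by move=> /IHp hp; apply: D.
- by move=> /IHp hp; apply: D.
Qed.

Section Semantics.
Variables (M : model L) (R : set ('I_n -> M)).
Implicit Types (X : team M) (s : assignment M) (t : nat -> M).

Definition agree m s t := forall j, j < m -> s (g j) = Some (t j).

Lemma agree_aupd m s t c : agree m s t -> agree m.+1 (aupd s (g m) c) (upd t m c).
Proof.
move=> st j; rewrite ltnS leq_eqVlt => /orP[/eqP->|jm].
  by rewrite /aupd /upd !eqxx.
by rewrite /aupd /upd (inj_eq g_inj) !ltn_eqF //; apply: st.
Qed.

Lemma agree_values m s t k (a : 'I_k -> nat) d : agree m s t ->
  (forall i, a i < m) ->
  (forall i, value s (@Var L (g (a i))) (d i)) <-> d = (fun i => t (a i)).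
Proof.
move=> st am; split=> [h|-> i]; last exact: st.
by apply/funext => i; have := h i; rewrite /= st // => -[].
Qed.

Lemma fresh_aupd s m c i : i < n -> aupd s (g m) c (K + i) = s (K + i).
Proof.
move=> ni; rewrite /aupd; case: eqP => // E; have := g_fresh m.
by rewrite -E leq_addr ltn_add2l ni.
Qed.

(** [LR] is set apart because it becomes an inclusion atom, whose truth depends on the whole
    team. *)
Lemma agree_lit m s t l : lit_scoped m l -> agree m s t ->
  match l with LR _ => True | _ =>
    tsat [set s] (lit_iformula l) <-> @lit_holds _ _ (expand R) t l end.
Proof.
case: l => [[] i j|f a j|[] r a|//] /=.
- move=> [im jm] st; split=> [/(_ s erefl)|E _ ->].
    by move=> [d [e []]]; rewrite !st // => -[->] [->].
  by exists (t i), (t j); rewrite !st.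
- move=> [im jm] st; split=> [/(_ s erefl)|E _ ->].
    by move=> [d [e []]]; rewrite !st // => -[->] [->].
  by exists (t i), (t j); rewrite !st.
- move=> [am jm] st; split=> [/(_ s erefl)|E _ ->].
    move=> [d [e [[h /(agree_values _ st am)-> ->]]]]; rewrite st // => -[->].
    by [].
  exists (t j), (t j); rewrite st //; split=> //.
  by exists (fun i => t (a i)); [apply/(agree_values _ st am)|].
- move=> am st; split=> [/(_ s erefl)[d /(agree_values _ st am)->]//|h _ ->].
  by exists (fun i => t (a i)); [apply/(agree_values _ st am)|].
- move=> am st; split=> [/(_ s erefl)[d /(agree_values _ st am)->]//|h _ ->].
  by exists (fun i => t (a i)); [apply/(agree_values _ st am)|].
Qed.

Lemma tsat_lit_flat X l : (if l is LR _ then False else True) ->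
  tsat X (lit_iformula l) <-> forall s, X s -> tsat [set s] (lit_iformula l).
Proof.
by case: l => [[] i j|f a j|[] r a|a] //= _;
  (split=> [h s Xs _ ->|h s Xs]; [exact: h|exact: (h s Xs s)]).
Qed.

(** That y takes values in R passes to subteams and survives quantifiers, whose variables differ
    from y; an inclusion in y then yields R. *)
Lemma pos_iformula_sound p m X : scoped m p -> tsat X (pos_iformula m p) ->
  team_image X fresh_vars `<=` R ->
  forall s t, X s -> agree m s t -> @pos_holds _ _ (expand R) m t p.
Proof.
elim: p m X => [l|||p IHp q IHq|p IHp q IHq|p IHp|p IHp] m X /=.
- move=> lm Xl XR s t Xs st; have := agree_lit lm st.
  case: l lm Xl => [[] i j|f a j|[] r a|a] lm Xl; do ?by
    [move=> <-; move: Xl => /tsat_lit_flat; apply].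
  move=> _ /=; apply: XR; apply: Xl; exists s => //.
  exact/(agree_values _ st lm).
- by [].
- move=> _ [H H0 h] _ s t Xs _; have [c Hc] := H0 s Xs.
  have [|d [e []]] := h (aupd s (g m) c); first by exists s, c.
  by rewrite /aupd /= eqxx => -[->] [->].
- move=> [/IHp hp /IHq hq] [Xp Xq] XR s t Xs st.
  by split; [apply: hp Xp XR s t Xs st|apply: hq Xq XR s t Xs st].
- move=> [/IHp hp /IHq hq] [Y [Z [-> Yp Zq]]] XR s t [Ys|Zs] st.
    left; apply: hp Yp _ s t Ys st => d [s' Ys' s'd].
    by apply: XR; exists s' => //; left.
  right; apply: hq Zq _ s t Zs st => d [s' Zs' s'd].
  by apply: XR; exists s' => //; right.
- move=> /IHp hp Xp XR s t Xs st c.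
  apply: hp Xp _ (aupd s (g m) c) _ _ (agree_aupd c st); last by exists s, c.
  move=> d [_ [s' [c' [Xs' ->]]] s'd]; apply: XR; exists s' => // i.
  by have := s'd i; rewrite /= fresh_aupd.
- move=> /IHp hp [H H0 Xp] XR s t Xs st; have [c Hc] := H0 s Xs; exists c.
  apply: hp Xp _ (aupd s (g m) c) _ _ (agree_aupd c st); last by exists s, c.
  move=> d [_ [s' [c' [Xs' _ ->]]] s'd]; apply: XR; exists s' => // i.
  by have := s'd i; rewrite /= fresh_aupd.
Qed.

(** Only the first k variables of the block are set, so that y can be chosen one variable at a
    time. *)
Definition set_fresh k s (r : 'I_n -> M) : assignment M :=
  fun w => if K <= w < K + k then omap r (insub (w - K)) else s w.

Lemma set_fresh_g k s r j : k <= n -> set_fresh k s r (g j) = s (g j).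
Proof.
move=> kn; rewrite /set_fresh; case: ifP => // /andP[h1 h2].
by have := g_fresh j; rewrite h1 (leq_trans h2) ?leq_add2l.
Qed.

Lemma set_fresh_fresh s r (i : 'I_n) : set_fresh n s r (K + i) = Some (r i).
Proof. by rewrite /set_fresh leq_addr ltn_add2l ltn_ord addKn valK. Qed.

Lemma set_fresh_aupd s r m c :
  set_fresh n (aupd s (g m) c) r = aupd (set_fresh n s r) (g m) c.
Proof.
apply/funext => w; rewrite /aupd /set_fresh; case: eqP => // ->.
by rewrite (negbTE (g_fresh m)).
Qed.

(* This makes [R t] equivalent to [t <= y], and it survives all team operations
   whose choices do not depend on y. *)
Definition full X := forall s r, X s -> R r -> X (set_fresh n s r).

Lemma pos_iformula_complete p m X : scoped m p -> full X ->
  (forall s, X s -> exists2 t, agree m s t & @pos_holds _ _ (expand R) m t p) ->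
  tsat X (pos_iformula m p).
Proof.
have agree_fresh m0 s t r : agree m0 s t -> agree m0 (set_fresh n s r) t.
  by move=> st j jm; rewrite set_fresh_g // st.
elim: p m X => [l|||p IHp q IHq|p IHp q IHq|p IHp|p IHp] m X /=.
- move=> lm fX h.
  case: l lm h => [[] i j|f a j|[] r a|a] lm h; do ?by
    [apply/tsat_lit_flat => // s /h[t st]; have := agree_lit lm st; move=> ->].
  (* The value d of the tuple lies in R, so fullness gives an assignment in which y is d. *)
  move=> d [s Xs sd]; have [t st Rt] := h s Xs.
  exists (set_fresh n s d); last by move=> i; apply: set_fresh_fresh.
  apply: fX => //; have -> // : d = (fun i => t (a i)).
  exact/(agree_values _ st lm).
- move=> _ _ _ _ [s [c [_ ->]]]; exists c, c.
  by rewrite /aupd /= eqxx.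
(* The hypothesis makes X empty, so the choice function is arbitrary. *)
- move=> _ _ h; exists (fun=> set0) => [s /h[]//|_ [s [c []]]//].
- move=> [pm qm] fX h; split; [apply: IHp|apply: IHq] => // s /h[t st []];
  by exists t.
- move=> [pm qm] fX h.
  (* The team is split by the truth of the disjuncts, which does not depend on y, so both parts
     remain full. *)
  exists [set s | X s /\ exists2 t, agree m s t & @pos_holds _ _ (expand R) m t p],
    [set s | X s /\ exists2 t, agree m s t & @pos_holds _ _ (expand R) m t q].
  split.
  + apply/seteqP; split=> [s Xs|s [[]|[]]//].
    by have [t st [ht|ht]] := h s Xs; [left|right]; split=> //; exists t.
  + apply: IHp => // [s r [Xs [t st ht]] Rr|s [_]//]; split; first exact: fX.
    by exists t => //; apply: agree_fresh.
  + apply: IHq => // [s r [Xs [t st ht]] Rr|s [_]//]; split; first exact: fX.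
    by exists t => //; apply: agree_fresh.
- move=> pm fX h; apply: IHp => // [_ r [s [c [Xs ->]]] Rr|_ [s [c [Xs ->]]]].
    by exists (set_fresh n s r), c; rewrite set_fresh_aupd; split=> //; apply: fX.
  by have [t st ht] := h s Xs; exists (upd t m c); [exact: (agree_aupd c st)|exact: ht].
- move=> pm fX h.
  (* All witnesses are chosen at once; again the choice does not depend on y. *)
  exists (fun s => [set c | exists2 t, agree m s t &
    @pos_holds _ _ (expand R) m.+1 (upd t m c) p]).
    by move=> s /h[t st [c hc]]; exists c; exists t.
  apply: IHp => // [_ r [s [c [Xs [t st ht] ->]]] Rr|_ [s [c [Xs [t st ht] ->]]]].
    exists (set_fresh n s r), c; rewrite set_fresh_aupd; split=> //; first exact: fX.
    by exists t => //; apply: agree_fresh.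
  by exists (upd t m c); [exact: (agree_aupd c st)|exact: ht].
Qed.

Definition exists_fresh k d (p : iformula L) : iformula L :=
  foldr (@IEx L) p [seq K + i | i <- iota k d].

Lemma tsat_exists_fresh X p : X `<=` [set s | exists r, R r] ->
  tsat [set s' | exists s r, [/\ X s, R r & s' = set_fresh n s r]] p ->
  tsat X (exists_fresh 0 n p).
Proof.
move=> XR Xp.
pose Xk k : team M := [set s' | exists s r, [/\ X s, R r & s' = set_fresh k s r]].
(* Membership in [Xk 0] still asks for some tuple in R, which [XR] supplies. *)
have -> : X = Xk 0.
  have set0E s r : set_fresh 0 s r = s.
    apply/funext => w; rewrite /set_fresh addn0.
    by case: ifP => // /andP[h1 h2]; have := leq_trans h2 h1; rewrite ltnn.
  apply/seteqP; split=> [s Xs|s [s' [r [Xs' _ ->]]]]; last by rewrite set0E.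
  by have [r Rr] := XR s Xs; exists s, r; rewrite set0E.
suff H d k : k + d = n -> tsat (Xk k) (exists_fresh k d p) by apply: H; rewrite add0n.
elim: d k => [|d IHd] k; first by rewrite addn0 => ->.
move=> kdn; have kn : k < n by rewrite -kdn addnS ltnS leq_addr.
have setS s r : set_fresh k.+1 s r
    = aupd (set_fresh k s r) (K + k) (r (Ordinal kn)).
  apply/funext => w; rewrite /aupd /set_fresh addnS ltnS.
  have [->|wk] := eqVneq w (K + k).
    by rewrite leq_addr leqnn addKn (insubT (fun i => i < n) kn).
  by rewrite (leq_eqVlt w) (negbTE wk).
(* The values allowed for the next variable are those that continue to a tuple in R. *)
exists (fun s' => [set c | Xk k.+1 (aupd s' (K + k) c)]).
  move=> _ [s [r [Xs Rr ->]]]; exists (r (Ordinal kn)); exists s, r.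
  by rewrite setS.
suff -> : supplement (Xk k) (fun s' => [set c | Xk k.+1 (aupd s' (K + k) c)]) (K + k)
    = Xk k.+1 by apply: IHd; rewrite addSnnS.
apply/seteqP; split=> [_ [s' [c [_ h ->]]]//|_ [s [r [Xs Rr ->]]]].
exists (set_fresh k s r), (r (Ordinal kn)); rewrite setS; split=> //.
  by exists s, r.
by exists s, r; rewrite setS.
Qed.

(** The block is disjoint from the range of [g], so choosing y changes the team only outside the
    variables [g j]. *)
Lemma exists_fresh_tsat X p : tsat X (exists_fresh 0 n p) ->
  exists2 X', tsat X' p &
    (forall s, X s -> exists2 s', X' s' & forall j, s' (g j) = s (g j)) /\
    (forall s', X' s' -> exists2 s, X s & forall j, s' (g j) = s (g j)).
Proof.
rewrite /exists_fresh; have : forall v, v \in [seq K + i | i <- iota 0 n] -> K <= v < K + n.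
  by move=> _ /mapP[i + ->]; rewrite mem_iota leq_addr ltn_add2l.
elim: (map _ _) X => [|v l IHl] X fl /= Xp.
  by exists X => //; split=> s Xs; exists s.
have vg s c j : aupd s v c (g j) = s (g j).
  rewrite /aupd; case: eqP => // E; have := fl v (mem_head _ _).
  by rewrite -E (negbTE (g_fresh j)).
have [H H0 /IHl[|X' X'p [h1 h2]]] := Xp.
  by move=> w wl; apply: fl; rewrite in_cons wl orbT.
exists X' => //; split=> [s Xs|s' /h2[_ [s [c [Xs _ ->]]] E]].
  have [c Hc] := H0 s Xs; have [|s' Xs' E] := h1 (aupd s v c); first by exists s, c.
  by exists s' => // j; rewrite E vg.
by exists s => // j; rewrite E vg.
Qed.

End Semantics.

Lemma ifv_exists_fresh p : ifv (exists_fresh 0 n p) `<=` [set v | ifv p v /\ ~~ (K <= v < K + n)].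
Proof.
have H l : ifv (foldr (@IEx L) p l) `<=` [set v | ifv p v /\ v \notin l].
  elim: l => [|w l IHl] v /=; first by [].
  move=> [/IHl[pv vl]] vw; split=> //; rewrite in_cons negb_or vl andbT.
  exact/eqP.
move=> v /H[pv /negP vl]; split=> //; apply/negP => /andP[Kv vK]; apply: vl.
apply/mapP; exists (v - K); last by rewrite subnKC.
by rewrite mem_iota /= add0n ltn_subLR.
Qed.

End InclusionLogic.

(** * The Inclusion Logic formula of a myopic sentence *)

Lemma myopic_iformula L n (phi : formula (add_rel L n)) (theta : pos L n) :
  scoped n theta ->
  (forall A : model (add_rel L n), models A phi <->
      forall s : nat -> A, @relI _ A None (fun i => s i) -> pos_holds n s theta) ->
  forall x : 'I_n -> nat, injective x ->
     exists2 phi_plus : iformula L,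
       ifv phi_plus `<=` range x &
       forall (M : model L) (V : set nat) (X : team M),
         has_domain X V -> range x `<=` V ->
         (tsat X phi_plus <->
          models (expand (team_image X (fun i => @Var L (x i)))) phi).
Proof.
move=> theta_n phiE x x_inj; pose K := (\max_i x i).+1.
have xK i : x i < K by rewrite ltnS leq_bigmax.
(* Levels below n are the variables x, all below [K]; a level [j >= n] becomes [K + j], beyond the
   block from [K] to [K + n]. *)
pose g j := oapp x (K + j) (insub j).
have gx (i : 'I_n) : g i = x i by rewrite /g valK.
have gN j : n <= j -> g j = K + j by move=> nj; rewrite /g insubN // -leqNgt.
have g_inj : injective g.
  move=> i j; case: (ltnP i n) (ltnP j n) => [ni|ni] [nj|nj].
  - by rewrite (gx (Ordinal ni)) (gx (Ordinal nj)) => /x_inj[].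
  - rewrite (gx (Ordinal ni)) gN // => E; have := xK (Ordinal ni).
    by rewrite E ltnNge leq_addr.
  - rewrite (gx (Ordinal nj)) gN // => E; have := xK (Ordinal nj).
    by rewrite -E ltnNge leq_addr.
  - by rewrite !gN // => /addnI.
have g_fresh j : ~~ (K <= g j < K + n).
  case: (ltnP j n) => nj; first by rewrite (gx (Ordinal nj)) leqNgt xK.
  by rewrite gN // ltn_add2l ltnNge nj andbF.
pose xs : 'I_n -> term L := fun i => Var (x i).
exists (exists_fresh K 0 n (IAnd (IInc (@fresh_vars L n K) xs) (pos_iformula g K n theta))).
  move=> v /ifv_exists_fresh[/= [[i _ [->|->]]|/(ifv_pos_iformula theta_n)[[j jn ->]|->]]] //.
  - by rewrite leq_addr ltn_add2l ltn_ord.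
  - by exists i.
  - by exists (Ordinal jn) => //; rewrite -gx.
move=> M V X XV xV; set R := team_image X xs.
have Xx s : X s -> exists r : 'I_n -> M, forall i, s (x i) = Some (r i).
  move=> Xs; suff /choice[r rP] : forall i, exists m, s (x i) = Some m by exists r.
  move=> i; have : V (x i) by apply: xV; exists i.
  by rewrite -(XV s Xs) /=; case: (s (x i)) => // m _; exists m.
split=> [/(exists_fresh_tsat g_fresh)[X' [inc Xp] [h1 h2]]|/phiE hR].
  apply/phiE => t [s Xs st]; have [s' X's' E] := h1 s Xs.
  apply: (pos_iformula_sound g_inj g_fresh theta_n Xp) X's' _.
    move=> d /inc[s1 /h2[s2 Xs2 E2] s1d]; exists s2 => // i.
    by have := s1d i; rewrite /= -gx E2.
  by move=> j jn; rewrite E (gx (Ordinal jn)); apply: (st (Ordinal jn)).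
(* Here y is given all values in R, independently of the rest of the assignment, which makes the
   team full. *)
apply: (tsat_exists_fresh (R := R)).
  by move=> s Xs; have [r rP] := Xx s Xs; exists r; exists s.
split=> [d [_ [s [r [Xs Rr ->]]] sd]|].
  have -> : d = r.
    by apply/funext => i; have := sd i; rewrite /= set_fresh_fresh => -[].
  have [s0 Xs0 s0r] := Rr; exists (set_fresh K n s0 r); first by exists s0, r.
  by move=> i; rewrite /= -gx set_fresh_g // gx; apply: s0r.
apply: (pos_iformula_complete g_inj g_fresh theta_n (R := R)).
  move=> _ r' [s [r [Xs Rr ->]]] Rr'; exists s, r'; split=> //.
  by apply/funext => w; rewrite /set_fresh; case: (K <= w < K + n).
move=> _ [s [r [Xs Rr ->]]]; have [d dP] := Xx s Xs.
pose t j := oapp d (point M) (insub j).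
have td (i : 'I_n) : t i = d i by rewrite /t valK.
exists t => [j jn|].
  by rewrite set_fresh_g // (gx (Ordinal jn)) dP (td (Ordinal jn)).
apply: hR; exists s => // i; rewrite /= dP; congr Some.
exact/esym/td.
Qed.

Theorem theorem26 (L : signature) (n : nat) (phi : formula (add_rel L n))
    (phi_sentence : sentence phi) (phi_closed : union_closed phi) :
  (exists psi : formula (add_rel L n), myopic psi /\ equivalent phi psi) /\
  (forall x : 'I_n -> nat, injective x ->
     exists2 phi_plus : iformula L,
       ifv phi_plus `<=` range x &
       forall (M : model L) (V : set nat) (X : team M),
         has_domain X V -> range x `<=` V ->
         (tsat X phi_plus <->
          models (expand (team_image X (fun i => @Var L (x i)))) phi)).
Proof.
have [theta theta_n phiE] := union_closed_pos phi_sentence phi_closed.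
split; last exact: myopic_iformula theta_n phiE.
exists (forall_tuple (fun i : 'I_n => val i)
  (FImp (@FRel (add_rel L n) None (fun i : 'I_n => Var (val i)))
        (pos_formula n theta))); split.
  exists (fun i => val i), (pos_formula n theta); split=> //.
  - exact: val_inj.
  - by move=> v /(fv_pos_formula theta_n) vn; exists (Ordinal vn).
  - exact: polarity_pos_formula.
move=> A; rewrite phiE /models sat_forall_tuple.
by split=> h s /= /h/sat_pos_formula.
Qed.
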